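(* Let $X$ be a (uniformly discrete) bounded geometry metric space equipped with a free, proper, and isometric right action of a countable discrete group $\Gamma$. The space $X$ admits an equivariant coarse embedding into Hilbert space if and only if its equivariant coarse groupoid $G(X,\Gamma)$ is a-T-menable.
   Context: Bounded geometry: $\sup_{x\in X}\#B(x,R)<\infty$ for all $R\ge 0$. $\beta D$ denotes the Stone--Čech compactification of a discrete space $D$. **Equivariant coarse groupoid.** Let $\Gamma$ act diagonally on $X\times X$, and let $\Delta_R=\{(x,y)\in X\times X: d(x,y)\le R\}$. Set $G(X,\Gamma)=\bigcup_{R\ge0}\overline{\Delta_R/\Gamma}\subseteq\beta((X\times X)/\Gamma)$ with the subspace topology. On the dense subset $(X\times X)/\Gamma$ the range, source, inverse, unit and product are $r([x,y])=[x]$, $s([x,y])=[y]$, $[x,y]^{-1}=[y,x]$, $[x]\mapsto[x,x]$, $[x,y]\circ[y\gamma,z]=[x,z\gamma^{-1}]$; these extend continuously to a topological groupoid structure on $G(X,\Gamma)$ with unit space $\beta(X/\Gamma)$, which is locally compact, Hausdorff and étale. **Equivariant coarse embedding.** A map $f:X\to\mathcal H$ into a Hilbert space equipped with a right affine isometric action of $\Gamma$ such that $f(x\gamma)=f(x)\cdot\gamma$ for all $x,\gamma$, and such that there are nondecreasing functions $\rho_\pm:[0,\infty)\to[0,\infty)$ with $\rho_-(t)\to\infty$ as $t\to\infty$ and $\rho_-(d(x,y))\le\|f(x)-f(y)\|\le\rho_+(d(x,y))$ for all $x,y\in X$. **A-T-menability.** A continuous function $\psi:\mathcal G\to\mathbb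 R$ on an étale groupoid is conditionally negative definite if $\psi(g)=\psi(g^{-1})$, $\psi(u)=0$ for $u\in\mathcal G^{(0)}$, and for every $u\in\mathcal G^{(0)}$, $g_1,\dots,g_n\in s^{-1}(u)$ and real $c_1,\dots,c_n$ with $\sum c_i=0$ one has $\sum_{i,j}c_ic_j\psi(g_ig_j^{-1})\le0$. $\mathcal G$ is a-T-menable if it admits a proper continuous conditionally negative definite function. *)

(* Defs.v *)
From HB Require Import structures.
From mathcomp Require Import all_boot all_order all_algebra.
From mathcomp Require Import all_classical all_reals all_analysis.

Set Implicit Arguments.
Unset Strict Implicit.
Unset Printing Implicit Defensive.

Import Order.TTheory GRing.Theory Num.Theory.
Import numFieldNormedType.Exports.

Local Open Scope classical_set_scope.
Local Open Scope quotient_scope.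
Local Open Scope ring_scope.

Record rightAction (Gam : groupType) (T : Type) := RightAction {
  ract :> T -> Gam -> T;
  ract1 : forall x, ract x 1%g = x;
  ractM : forall x a b, ract x (a * b)%g = ract (ract x a) b
}.

Section OrbitSpace.
Variables (Gam : groupType) (T : choiceType) (act : rightAction Gam T).

Definition orbit_rel : rel T := fun x y => `[< exists a, y = act x a >].

Lemma orbit_refl : reflexive orbit_rel.
Proof. by move=> x; apply/asboolP; exists 1%g; rewrite ract1. Qed.

Lemma orbit_sym : symmetric orbit_rel.
Proof.
have H x y : orbit_rel x y -> orbit_rel y x.
  by move=> /asboolP[a ->]; apply/asboolP; exists a^-1%g;
     rewrite -ractM mulgV ract1.
by move=> x y; apply/idP/idP => /H.
Qed.

Lemma orbit_trans : transitive orbit_rel.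
Proof.
move=> y x z /asboolP[a ->] /asboolP[b ->].
by apply/asboolP; exists (a * b)%g; rewrite ractM.
Qed.

Canonical orbit_equiv := EquivRel orbit_rel orbit_refl orbit_sym orbit_trans.

Definition orbit_space : Type := {eq_quot orbit_equiv}.

Definition orbit_of (x : T) : orbit_space := \pi_({eq_quot orbit_equiv}) x.

Definition orbit_repr (u : orbit_space) : T := repr (u : {eq_quot orbit_equiv}).

Lemma orbit_reprK u : orbit_of (orbit_repr u) = u.
Proof. exact: reprK. Qed.

Lemma orbit_ofP x y : orbit_of x = orbit_of y <-> exists a, y = act x a.
Proof.
split => [/eqmodP/asboolP //|h].
by apply/eqmodP/asboolP.
Qed.

Lemma orbit_of_act x a : orbit_of (act x a) = orbit_of x.
Proof. by apply/esym/orbit_ofP; exists a. Qed.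

End OrbitSpace.

Section Diagonal.
Variables (Gam : groupType) (T : Type) (act : rightAction Gam T).

Definition diag_fun (p : T * T) (a : Gam) : T * T := (act p.1 a, act p.2 a).

Lemma diag1 p : diag_fun p 1%g = p.
Proof. by case: p => x y; rewrite /diag_fun /= !ract1. Qed.

Lemma diagM p a b : diag_fun p (a * b)%g = diag_fun (diag_fun p a) b.
Proof. by rewrite /diag_fun /= !ractM. Qed.

Definition diag_act : rightAction Gam (T * T)%type := RightAction diag1 diagM.

End Diagonal.

(* For a discrete space [D], the Stone-Cech compactification is the space of
   ultrafilters on [D], with the sets [sc_basic A] as a base of open sets; the
   principal ultrafilters [sc_in x] form the dense copy of [D]. *)
Record stone_cech (D : Type) := StoneCech {
  sc_sets :> set_system D;
  sc_ultra : UltraFilter sc_sets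
}.

#[export] Existing Instance sc_ultra.

Section StoneCech.
Variable D : Type.
Implicit Types F G : stone_cech D.

HB.instance Definition _ := gen_eqMixin (stone_cech D).
HB.instance Definition _ := gen_choiceMixin (stone_cech D).

Definition sc_basic (A : set D) : set (stone_cech D) := [set F | sc_sets F A].

Definition sc_open (U : set (stone_cech D)) : Prop :=
  forall F, U F -> exists2 A, sc_sets F A & sc_basic A `<=` U.

Lemma sc_openT : sc_open setT.
Proof. by move=> F _; exists setT => //; apply: filterT. Qed.

Lemma sc_openI : setI_closed sc_open.
Proof.
move=> U V oU oV F [/oU[A FA AU] /oV[B FB BV]].
exists (A `&` B); first exact: filterI.
move=> K KAB; split.
  by apply: AU; apply: (filterS _ KAB) => x [].
by apply: BV; apply: (filterS _ KAB) => x [].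
Qed.

Lemma sc_open_bigcup (I : Type) (f : I -> set (stone_cech D)) :
  (forall i, sc_open (f i)) -> sc_open (\bigcup_i f i).
Proof.
move=> of_ F [i _ /of_[A FA Af]]; exists A => //.
by move=> K /Af fK; exists i.
Qed.

HB.instance Definition _ := isOpenTopological.Build (stone_cech D)
  sc_openT sc_openI sc_open_bigcup.

Lemma sc_eq F G : (forall A, sc_sets F A -> sc_sets G A) -> F = G.
Proof.
case: F G => [F uF] [G uG] /= FG.
have E : G = F by apply: max_filter.
by subst G; congr StoneCech; exact: Prop_irrelevance.
Qed.

Lemma sc_setC F A : ~ sc_sets F A -> sc_sets F (~` A).
Proof. by move=> nA; have [|//] := @in_ultra_setVsetC _ F A _. Qed.

Lemma sc_not F A : sc_sets F A -> sc_sets F (~` A) -> False.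
Proof.
by move=> h1 h2; have /filter_ex[x []] : sc_sets F (A `&` ~` A) by apply: filterI.
Qed.

Lemma sc_basic_open A : open (sc_basic A).
Proof. by move=> F FA; exists A. Qed.

Lemma sc_nbhsP F (U : set (stone_cech D)) :
  nbhs F U <-> exists2 A, sc_sets F A & sc_basic A `<=` U.
Proof.
split=> [|[A FA AU]].
  rewrite nbhsE => -[V [oV VF] VU].
  have [A FA AV] := oV _ VF.
  by exists A => //; exact: subset_trans VU.
by rewrite nbhsE; exists (sc_basic A) => //; split => //; exact: sc_basic_open.
Qed.

Lemma ultra_prime (F : set_system D) : ProperFilter F ->
  (forall A, F A \/ F (~` A)) -> UltraFilter F.
Proof.
move=> PF h; split=> // G PG FG; rewrite eqEsubset; split=> // A GA.
have [//|/FG GnA] := h A.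
by have /filter_ex[x []] : G (A `&` ~` A) by exact: filterI.
Qed.

Definition sc_in (x : D) : stone_cech D :=
  StoneCech (principal_filter_ultra x).

Lemma sc_inE x A : sc_sets (sc_in x) A <-> A x.
Proof. by split => /principal_filterP. Qed.

Lemma sc_closureE A F : closure (sc_in @` A) F <-> sc_sets F A.
Proof.
split=> [cl|FA U /sc_nbhsP[B FB BU]].
  apply: contrapT => /sc_setC FnA.
  have [_ [[x Ax <-] /sc_inE]] := cl _ (open_nbhs_nbhs (conj (@sc_basic_open (~` A)) FnA)).
  by apply.
have /filter_ex[x [Ax Bx]] : sc_sets F (A `&` B) by exact: filterI.
by exists (sc_in x); split; [exists x|apply: BU; exact/sc_inE].
Qed.

End StoneCech.

Section StoneCechMap.
Variables (D E : Type) (f : D -> E).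

Lemma sc_map_ultra (F : stone_cech D) : UltraFilter (f @ sc_sets F).
Proof.
apply: ultra_prime => A; rewrite /fmap /=.
have [FA|/sc_setC] := pselect (sc_sets F (f @^-1` A)); first by left.
by right.
Qed.

(* the unique continuous extension of [f] *)
Definition sc_map (F : stone_cech D) : stone_cech E := StoneCech (sc_map_ultra F).

Lemma sc_mapE F A : sc_sets (sc_map F) A = sc_sets F (f @^-1` A).
Proof. by []. Qed.

Lemma sc_map_in x : sc_map (sc_in x) = sc_in (f x).
Proof. by apply: sc_eq => A; rewrite sc_mapE => /sc_inE ?; apply/sc_inE. Qed.

Lemma sc_map_continuous : continuous sc_map.
Proof.
move=> F U /sc_nbhsP[A FA AU]; apply/sc_nbhsP.
by exists (f @^-1` A) => // G GA; exact: AU.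
Qed.

End StoneCechMap.

(* Continuity, together with a neighbourhood of each point on which the map is
   injective and open. *)
Definition local_homeo (S T : topologicalType) (f : S -> T) : Prop :=
  continuous f /\
  forall x, exists2 U, open_nbhs x U &
    (forall y z, U y -> U z -> f y = f z -> y = z) /\
    (forall V, open V -> V `<=` U -> open (f @` V)).

(* [gmul g h] is the product of the arrows [g] and [h] only when they are
   composable, i.e. [gsrc g = grng h]; its other values are irrelevant.
   Being etale is [gsrc_local_homeo]; it gives the same for [grng], since
   [grng g = gsrc (ginv g)]. *)
Record etaleGroupoid := EtaleGroupoid {
  garr :> topologicalType;
  gunits : topologicalType;
  grng : garr -> gunits;
  gsrc : garr -> gunits;
  gunit : gunits -> garr;
  ginv : garr -> garr;
  gmul : garr -> garr -> garr;
  grng_unit : forall u, grng (gunit u) = u;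
  gsrc_unit : forall u, gsrc (gunit u) = u;
  grng_inv : forall g, grng (ginv g) = gsrc g;
  gsrc_inv : forall g, gsrc (ginv g) = grng g;
  grng_mul : forall g h, gsrc g = grng h -> grng (gmul g h) = grng g;
  gsrc_mul : forall g h, gsrc g = grng h -> gsrc (gmul g h) = gsrc h;
  gmulA : forall g h k, gsrc g = grng h -> gsrc h = grng k ->
    gmul g (gmul h k) = gmul (gmul g h) k;
  gmul1g : forall g, gmul (gunit (grng g)) g = g;
  gmulg1 : forall g, gmul g (gunit (gsrc g)) = g;
  gmulgV : forall g, gmul g (ginv g) = gunit (grng g);
  gmulVg : forall g, gmul (ginv g) g = gunit (gsrc g);
  grng_continuous : continuous grng;
  gunit_continuous : continuous gunit;
  ginv_continuous : continuous ginv;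
  gmul_continuous : {within [set gh : garr * garr | gsrc gh.1 = grng gh.2],
    continuous (fun gh : garr * garr => gmul gh.1 gh.2)};
  gsrc_local_homeo : local_homeo gsrc;
  garr_hausdorff : hausdorff_space garr;
  garr_locally_compact : locally_compact [set: garr]
}.

Section ATMenable.
Variables (R : realType) (G : etaleGroupoid).

Record cond_neg_def (psi : G -> R) : Prop := CondNegDef {
  cnd_sym : forall g, psi g = psi (ginv g);
  cnd_unit : forall u : gunits G, psi (gunit u) = 0;
  cnd_neg : forall (u : gunits G) (n : nat) (g : 'I_n -> G) (c : 'I_n -> R),
    (forall i, gsrc (g i) = u) -> \sum_(i < n) c i = 0 ->
    \sum_(i < n) \sum_(j < n) c i * c j * psi (gmul (g i) (ginv (g j))) <= 0
}.

Definition proper_fun (psi : G -> R) : Prop :=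
  forall K : set R, compact K -> compact (psi @^-1` K).

Definition a_T_menable : Prop :=
  exists psi : G -> R,
    [/\ continuous psi, cond_neg_def psi & proper_fun psi].

End ATMenable.

Section MetricAction.
Variables (R : realType) (X : metricType R) (Gam : groupType)
  (act : rightAction Gam X).

Definition uniformly_discrete : Prop :=
  exists2 e : R, 0 < e & forall x y : X, x <> y -> e <= mdist x y.

Definition bounded_geometry : Prop :=
  forall r : R, 0 <= r -> exists N : nat,
    forall x : X, ([set y | mdist x y <= r] #<= `I_N)%card.

Definition free_action : Prop := forall x a, act x a = x -> a = 1%g.

Definition proper_action : Prop :=
  forall K : set X, compact K ->
    finite_set [set a | exists2 x, K x & K (act x a)].

Definition isometric_action : Prop :=
  forall a x y, mdist (act x a) (act y a) = mdist x y.

End MetricAction.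

(* A real Hilbert space: a Banach space whose norm comes from an inner product. *)
Record hilbertSpace (R : realType) := HilbertSpace {
  hilb :> completeNormedModType R;
  hdot : hilb -> hilb -> R;
  hdotC : forall u v, hdot u v = hdot v u;
  hdot_linear : forall a u v w,
    hdot (a *: u + v) w = a * hdot u w + hdot v w;
  hdot_norm : forall u, hdot u u = `|u| ^+ 2
}.

Section Embedding.
Variables (R : realType) (X : metricType R) (Gam : groupType)
  (act : rightAction Gam X).

Definition affine_map (V : lmodType R) (f : V -> V) : Prop :=
  exists (L : {linear V -> V}) (b : V), forall v, f v = L v + b.

Definition affine_isometric_action (H : hilbertSpace R)
    (actH : rightAction Gam H) : Prop :=
  forall a, affine_map (fun v => actH v a) /\
    forall v w, `|actH v a - actH w a| = `|v - w|.

Definition equivariant_coarse_embedding (H : hilbertSpace R)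
    (actH : rightAction Gam H) (f : X -> H) : Prop :=
  (forall x a, f (act x a) = actH (f x) a) /\
  exists rhom rhop : R -> R,
    [/\ (forall t, 0 <= t -> 0 <= rhom t) /\ (forall t, 0 <= t -> 0 <= rhop t),
        (forall s t, 0 <= s -> s <= t -> rhom s <= rhom t) /\
        (forall s t, 0 <= s -> s <= t -> rhop s <= rhop t),
        rhom t @[t --> +oo] --> +oo &
        forall x y, rhom (mdist x y) <= `|f x - f y| <= rhop (mdist x y)].

Definition equivariantly_embeddable : Prop :=
  exists (H : hilbertSpace R) (actH : rightAction Gam H) (f : X -> H),
    affine_isometric_action actH /\ equivariant_coarse_embedding actH f.

End Embedding.

Section OrbitPairs.
Variables (R : realType) (X : metricType R) (Gam : groupType)
  (act : rightAction Gam X).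

Local Notation D0 := (orbit_space act).
Local Notation D := (orbit_space (diag_act act)).

Definition pair_of (x y : X) : D := orbit_of (diag_act act) (x, y).

Definition pair_rng (p : D) : D0 := orbit_of act (orbit_repr p).1.
Definition pair_src (p : D) : D0 := orbit_of act (orbit_repr p).2.
Definition pair_inv (p : D) : D := pair_of (orbit_repr p).2 (orbit_repr p).1.
Definition pair_unit (u : D0) : D := pair_of (orbit_repr u) (orbit_repr u).

(* The graph of the partially defined product [x,y] o [ya,z] = [x,za^-1]. *)
Definition pair_mul (p q k : D) : Prop := exists x y a z,
  [/\ p = pair_of x y, q = pair_of (act y a) z & k = pair_of x (act z a^-1%g)].

Lemma pair_ofP x y x' y' :
  pair_of x y = pair_of x' y' <-> exists a, x' = act x a /\ y' = act y a.
Proof.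
split=> [/orbit_ofP[a [-> ->]]|[a [-> ->]]]; first by exists a.
by apply/orbit_ofP; exists a.
Qed.

Lemma pair_of_act x y a : pair_of (act x a) (act y a) = pair_of x y.
Proof. by apply/esym/pair_ofP; exists a. Qed.

Lemma pair_reprK p : pair_of (orbit_repr p).1 (orbit_repr p).2 = p.
Proof. by rewrite /pair_of -surjective_pairing orbit_reprK. Qed.

Lemma pair_case p : exists x y, p = pair_of x y.
Proof. by exists (orbit_repr p).1, (orbit_repr p).2; rewrite pair_reprK. Qed.

Lemma pair_rng_of x y : pair_rng (pair_of x y) = orbit_of act x.
Proof.
have /pair_ofP[a [E _]] := pair_reprK (pair_of x y).
by rewrite /pair_rng [in RHS]E orbit_of_act.
Qed.

Lemma pair_src_of x y : pair_src (pair_of x y) = orbit_of act y.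
Proof.
have /pair_ofP[a [_ E]] := pair_reprK (pair_of x y).
by rewrite /pair_src [in RHS]E orbit_of_act.
Qed.

Lemma pair_inv_of x y : pair_inv (pair_of x y) = pair_of y x.
Proof.
have /pair_ofP[a [E1 E2]] := pair_reprK (pair_of x y).
by apply/pair_ofP; exists a.
Qed.

Lemma pair_unit_of x : pair_unit (orbit_of act x) = pair_of x x.
Proof.
have /orbit_ofP[a E] := orbit_reprK (orbit_of act x).
by apply/pair_ofP; exists a.
Qed.

Lemma pair_mul_of x y z : pair_mul (pair_of x y) (pair_of y z) (pair_of x z).
Proof. by exists x, y, 1%g, z; rewrite !ract1 invg1 ract1. Qed.

Lemma pair_mulP p q k : pair_mul p q k <-> exists x y z,
  [/\ p = pair_of x y, q = pair_of y z & k = pair_of x z].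
Proof.
split=> [[x [y [a [z [-> -> ->]]]]]|[x [y [z [-> -> ->]]]]];
  last exact: pair_mul_of.
exists x, y, (act z a^-1%g); split=> //.
by rewrite -(pair_of_act y _ a) -ractM mulVg ract1.
Qed.

Lemma pair_mul_ends p q k : pair_mul p q k ->
  [/\ pair_src p = pair_rng q, pair_rng k = pair_rng p & pair_src k = pair_src q].
Proof.
by move=> /pair_mulP[x [y [z [-> -> ->]]]]; rewrite !(pair_rng_of, pair_src_of).
Qed.

Lemma pair_mul_ex p q : pair_src p = pair_rng q -> exists k, pair_mul p q k.
Proof.
have [x [y ->]] := pair_case p; have [y' [z ->]] := pair_case q.
rewrite pair_src_of pair_rng_of => /orbit_ofP[a ->].
by exists (pair_of x (act z a^-1%g)), x, y, a, z.
Qed.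

Lemma pair_srcE p v : pair_src p = v -> exists x, p = pair_of x (orbit_repr v).
Proof.
have [x [y ->]] := pair_case p; rewrite pair_src_of => <-.
have /orbit_ofP[a E] := orbit_reprK (orbit_of act y).
by exists (act x a^-1%g); apply/esym/pair_ofP; exists a; rewrite -ractM mulVg ract1.
Qed.

(* [Delta_r / Gam] *)
Definition entourage_orbits (r : R) : set D :=
  orbit_of (diag_act act) @` [set xy | mdist xy.1 xy.2 <= r].

Definition coarse_set : set (stone_cech D) :=
  \bigcup_(r in [set r : R | 0 <= r]) closure (@sc_in D @` entourage_orbits r).

Definition coarse_arrow : topologicalType := set_type coarse_set.

Implicit Types g h : coarse_arrow.

Definition asc g : stone_cech D := val g.

Lemma pair_arrow_subproof p : sc_in p \in coarse_set.
Proof.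
have [x [y ->]] := pair_case p; rewrite inE; exists (mdist x y); first exact: mdist_ge0.
by apply/sc_closureE/sc_inE; exists (x, y) => //=.
Qed.

Definition pair_arrow (p : D) : coarse_arrow :=
  exist _ (sc_in p) (pair_arrow_subproof p).

Lemma coarse_setE (F : stone_cech D) : coarse_set F <->
  exists2 r : R, 0 <= r & sc_sets F (entourage_orbits r).
Proof. by split=> -[r r0] /sc_closureE ?; exists r => //; exact/sc_closureE. Qed.

Lemma arrow_bounded g :
  exists2 r : R, 0 <= r & sc_sets (asc g) (entourage_orbits r).
Proof. by apply/coarse_setE; have := valP g; rewrite inE. Qed.

Lemma arrow_ex (F : stone_cech D) r : 0 <= r -> sc_sets F (entourage_orbits r) ->
  exists g, asc g = F.
Proof.
move=> r0 Fr; have FG : F \in coarse_set by rewrite inE; apply/coarse_setE; exists r.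
by exists (exist _ F FG).
Qed.

Lemma arrow_eq g h :
  (forall A, sc_sets (asc g) A -> sc_sets (asc h) A) -> g = h.
Proof. by move=> gh; apply/val_inj/sc_eq. Qed.

Lemma arrow_nbhsP g (U : set coarse_arrow) :
  nbhs g U <-> exists2 A, sc_sets (asc g) A &
    forall h, sc_sets (asc h) A -> U h.
Proof.
split=> [|[A gA AU]].
  rewrite nbhsE => -[V [[W oW <-] Wg] VU].
  have [A gA AW] := oW _ Wg.
  by exists A => // h hA; apply: VU; exact: AW.
rewrite nbhsE; exists (asc @^-1` sc_basic A); last by move=> h; exact: AU.
by split=> //; exists (sc_basic A) => //; exact: sc_basic_open.
Qed.

Definition coarse_rng g : stone_cech D0 := sc_map pair_rng (asc g).
Definition coarse_src g : stone_cech D0 := sc_map pair_src (asc g).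

Lemma coarse_rngE g A :
  sc_sets (coarse_rng g) A = sc_sets (asc g) (pair_rng @^-1` A).
Proof. by []. Qed.

Lemma coarse_srcE g A :
  sc_sets (coarse_src g) A = sc_sets (asc g) (pair_src @^-1` A).
Proof. by []. Qed.

Definition mul_set (A B : set D) : set D :=
  [set k | exists p q, [/\ A p, B q & pair_mul p q k]].

(* The products of composable pairs of elements of [D] that tend to [(g, h)]. *)
Definition mul_filter g h : set_system D :=
  [set C | exists A B,
     [/\ sc_sets (asc g) A, sc_sets (asc h) B & mul_set A B `<=` C]].

(* The extension by continuity of the product of [D]; the default value [g] of
   [xget] is never used when [coarse_src g = coarse_rng h], see [coarse_mulE]. *)
Definition coarse_mul g h : coarse_arrow :=
  xget g [set k | pair_arrow @ mul_filter g h --> k].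

End OrbitPairs.

Arguments entourage_orbits {R X Gam} act r _.
Arguments coarse_set {R X Gam} act _.

Section CoarseGroupoid.
Variables (R : realType) (X : metricType R) (Gam : groupType)
  (act : rightAction Gam X).
Hypothesis act_free : free_action act.
Hypothesis act_isom : isometric_action act.
Hypothesis bgeom : bounded_geometry X.

Local Notation D0 := (orbit_space act).
Local Notation D := (orbit_space (diag_act act)).
Local Notation coarse_arrow := (coarse_arrow act).
Local Notation Delta := (entourage_orbits act).
Implicit Types g h : coarse_arrow.

Lemma act_inj x a b : act x a = act x b -> a = b.
Proof.
move=> E; have : act x (a * b^-1)%g = x by rewrite ractM E -ractM mulgV ract1.
by move/act_free/eqP; rewrite mulg_eq1 invgK => /eqP.
Qed.

Lemma pair_mul_fun p q k k' :
  pair_mul (act := act) p q k -> pair_mul p q k' -> k = k'.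
Proof.
move=> /pair_mulP[x [y [z [-> -> ->]]]] /pair_mulP[x' [y' [z' []]]].
move=> /pair_ofP[a [-> ->]] /pair_ofP[b [/act_inj <- ->]] ->.
by rewrite pair_of_act.
Qed.

Lemma pair_mulA p q t k m l : pair_mul (act := act) p q k -> pair_mul k t m ->
  pair_mul q t l -> pair_mul p l m.
Proof.
move=> /pair_mulP[x [y [z [-> -> ->]]]] /pair_mulP[x' [z' [w []]]].
move=> /pair_ofP[a [-> ->]] -> -> qt.
have -> : l = pair_of act y (act w a^-1%g).
  apply: (pair_mul_fun qt); apply/pair_mulP; exists y, z, (act w a^-1%g).
  by rewrite -(pair_of_act act z _ a) -ractM mulVg ract1.
apply/pair_mulP; exists x, y, (act w a^-1%g); split=> //.
by rewrite -[in RHS](pair_of_act act _ _ a) -ractM mulVg ract1.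
Qed.

Lemma Delta_of r x y : Delta r (pair_of act x y) <-> mdist x y <= r.
Proof.
split=> [[[x' y'] /= xy' /pair_ofP[a [-> ->]]]|xy]; first by rewrite act_isom.
by exists (x, y) => //=.
Qed.

Lemma Delta_inv r p : Delta r p -> Delta r (pair_inv p).
Proof.
have [x [y ->]] := pair_case p; rewrite pair_inv_of => /Delta_of xy.
by apply/Delta_of; rewrite metric_sym.
Qed.

Lemma Delta_unit u : Delta 0 (pair_unit (act := act) u).
Proof. by apply/Delta_of; rewrite mdistxx. Qed.

Lemma Delta_mul r t p q k : Delta r p -> Delta t q -> pair_mul p q k ->
  Delta (r + t) k.
Proof.
move=> Dp Dq /pair_mulP[x [y [z [E1 E2 ->]]]].
move: Dp Dq; rewrite E1 E2 => /Delta_of xy /Delta_of yz.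
by apply/Delta_of; apply: le_trans (metric_triangle _ y _) (lerD xy yz).
Qed.

Definition src_inj (A : set D) : Prop :=
  forall p q, A p -> A q -> pair_src p = pair_src q -> p = q.

Lemma ultra_color (F : stone_cech D) (c : D -> nat) n :
  sc_sets F [set p | (c p < n)%N] -> exists i, sc_sets F [set p | c p = i].
Proof.
elim: n => [|n IHn] Fn.
  by have /filter_ex[x] := Fn.
have [Fi|/sc_setC Fi] := pselect (sc_sets F [set p | c p = n]).
  by exists n.
apply: IHn; apply: (filterS _ (filterI Fn Fi)) => p [/=].
by rewrite ltnS leq_eqVlt => /orP[/eqP ->|].
Qed.

Lemma fibre_color r : 0 <= r -> exists N (c : D -> nat),
  (forall p, Delta r p -> (c p < N)%N) /\
  (forall p q, Delta r p -> Delta r q -> pair_src p = pair_src q ->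
     c p = c q -> p = q).
Proof.
move=> r0; have [N HN] := bgeom r0.
have /choice[f Hf] (y : X) : exists f : X -> nat,
    (forall x, mdist y x <= r -> (f x < N)%N) /\
    (forall x x', mdist y x <= r -> mdist y x' <= r -> f x = f x' -> x = x').
  have /pcard_leP/injfunPex[f fN fI] := HN y.
  exists f; split=> [x yx|x x' yx yx' E]; first exact: fN.
  by apply: fI E; rewrite inE.
have /choice[x0 Hx0] (p : D) : exists x, p = pair_of act x (orbit_repr (pair_src p)).
  exact: pair_srcE.
have dx0 p : Delta r p -> mdist (orbit_repr (pair_src p)) (x0 p) <= r.
  by rewrite {1}(Hx0 p) => /Delta_of; rewrite metric_sym.
exists N, (fun p => f (orbit_repr (pair_src p)) (x0 p)); split=> [p /dx0 Dp|p q].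
  by have [H _] := Hf (orbit_repr (pair_src p)); exact: H.
move=> /dx0 Dp /dx0 Dq E.
move: Dp Dq; rewrite -E => Dp Dq Ec; have [_ H] := Hf (orbit_repr (pair_src p)).
by rewrite (Hx0 p) (Hx0 q) -E (H _ _ Dp Dq Ec).
Qed.

Lemma src_inj_piece g : exists2 A, sc_sets (asc g) A &
  src_inj A /\ exists2 r : R, 0 <= r & A `<=` Delta r.
Proof.
have [r r0 gr] := arrow_bounded g.
have [N [c [cN cI]]] := fibre_color r0.
have [i gi] : exists i, sc_sets (asc g) [set p | c p = i].
  by apply: (@ultra_color _ _ N); apply: (filterS _ gr) => p; exact: cN.
exists (Delta r `&` [set p | c p = i]); first exact: filterI.
split; last by exists r => // p [].
by move=> p q [rp cp] [rq cq] E; apply: cI => //; rewrite cp cq.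
Qed.

Definition composable g h : Prop := coarse_src g = coarse_rng h.

Lemma mul_set_ex g h A B : composable g h -> sc_sets (asc g) A ->
  sc_sets (asc h) B -> mul_set A B !=set0.
Proof.
move=> gh gA hB.
have : sc_sets (coarse_src g) (@pair_src _ _ _ act @` A).
  by rewrite sc_mapE; apply: (filterS _ gA) => p Ap; exists p.
rewrite gh sc_mapE => hA.
have /filter_ex[q [[p Ap pq] Bq]] :
  sc_sets (asc h) (@pair_rng _ _ _ act @^-1` (@pair_src _ _ _ act @` A) `&` B).
  exact: filterI.
by have [k pqk] := pair_mul_ex pq; exists k, p, q.
Qed.

Lemma mul_filter_ultra g h : composable g h -> UltraFilter (mul_filter g h).
Proof.
move=> gh; apply: ultra_prime.
  apply: Build_ProperFilter_ex.
    move=> C [A [B [gA hB ABC]]].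
    by have [k ABk] := mul_set_ex gh gA hB; exists k; exact: ABC.
  split.
  - by exists setT, setT; split => //; exact: filterT.
  - move=> C C' [A [B [gA hB ABC]]] [A' [B' [gA' hB' ABC']]].
    exists (A `&` A'), (B `&` B'); split; try exact: filterI.
    move=> k [p [q [[Ap A'p] [Bq B'q] pqk]]]; split.
      by apply: ABC; exists p, q.
    by apply: ABC'; exists p, q.
  - move=> C C' CC' [A [B [gA hB ABC]]]; exists A, B; split => //.
    exact: subset_trans CC'.
move=> C; have [A gA [Ainj _]] := src_inj_piece g.
pose B : set D := [set q | exists p k, [/\ A p, C k & pair_mul p q k]].
have [hB|/sc_setC hB] := pselect (sc_sets (asc h) B); [left|right].
  exists A, B; split=> // k [p [q [Ap [p' [k' [Ap' Ck' pqk']]] pqk]]].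
  have [E _ _] := pair_mul_ends pqk; have [E' _ _] := pair_mul_ends pqk'.
  have pp' : p = p' by apply: Ainj; rewrite // E E'.
  by rewrite (pair_mul_fun pqk (k' := k')) // pp'.
exists A, (~` B); split=> // k [p [q [Ap nBq pqk]]] Ck.
by apply: nBq; exists p, k.
Qed.

Lemma coarse_mulE g h : composable g h ->
  forall C, sc_sets (asc (coarse_mul g h)) C <-> mul_filter g h C.
Proof.
move=> gh; have uF := mul_filter_ultra gh.
pose F := StoneCech uF.
have [r r0 gr] := arrow_bounded g; have [t t0 ht] := arrow_bounded h.
have [k kF] : exists k, asc k = F.
  apply: (@arrow_ex _ _ _ _ _ (r + t)); first exact: addr_ge0.
  exists (Delta r), (Delta t); split => // l [p [q [Dp Dq]]].
  exact: Delta_mul.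
have cvgE l : (@pair_arrow _ _ _ act @ mul_filter g h --> l) <->
    asc l = F.
  split=> [cvl|lF U /arrow_nbhsP[A lA AU]].
    apply: sc_eq => C lC.
    have /cvl : nbhs l [set m | sc_sets (asc m) C] by apply/arrow_nbhsP; exists C.
    move=> mC.
    have {}mC : sc_sets F [set p | sc_sets (sc_in p) C] by exact: mC.
    by apply: (filterS _ mC) => p /sc_inE.
  have : sc_sets F A by rewrite -lF.
  move=> FA; have : sc_sets F (@pair_arrow _ _ _ act @^-1` U); last by [].
  by apply: (filterS _ FA) => p Ap; apply: AU; exact/sc_inE.
have -> : asc (coarse_mul g h) = F.
  by apply/cvgE; rewrite /coarse_mul; case: xgetP => // /(_ k); case; apply/cvgE.
by [].
Qed.

Lemma coarse_mul_set g h A B : composable g h -> sc_sets (asc g) A ->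
  sc_sets (asc h) B -> sc_sets (asc (coarse_mul g h)) (mul_set A B).
Proof. by move=> gh gA hB; apply/(coarse_mulE gh); exists A, B; split. Qed.

Lemma coarse_mul_eq g h k : composable g h ->
  (forall A B, sc_sets (asc g) A -> sc_sets (asc h) B ->
     sc_sets (asc k) (mul_set A B)) -> coarse_mul g h = k.
Proof.
move=> gh H; apply: arrow_eq => C /(coarse_mulE gh)[A [B [gA hB ABC]]].
by apply: (filterS ABC); exact: H.
Qed.

Lemma coarse_mul_pair p q k : pair_mul (act := act) p q k ->
  coarse_mul (pair_arrow p) (pair_arrow q) = pair_arrow k.
Proof.
move=> pqk; have [E _ _] := pair_mul_ends pqk.
apply: coarse_mul_eq => [|A B /sc_inE Ap /sc_inE Bq].
  transitivity (sc_in (pair_src p)); first exact: sc_map_in.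
  by rewrite E; apply/esym; exact: sc_map_in.
by apply/sc_inE; exists p, q.
Qed.

Lemma coarse_unit_subproof (u : stone_cech D0) :
  sc_map (@pair_unit _ _ _ act) u \in coarse_set act.
Proof.
rewrite inE; apply/coarse_setE; exists 0 => //.
by rewrite sc_mapE; apply: filterS filterT => v _; exact: Delta_unit.
Qed.

Definition coarse_unit (u : stone_cech D0) : coarse_arrow :=
  exist _ (sc_map (@pair_unit _ _ _ act) u) (coarse_unit_subproof u).

Lemma coarse_inv_subproof g : sc_map (@pair_inv _ _ _ act) (asc g) \in coarse_set act.
Proof.
rewrite inE; apply/coarse_setE; have [r r0 gr] := arrow_bounded g.
exists r => //; rewrite sc_mapE; apply: (filterS _ gr) => p; exact: Delta_inv.
Qed.

Definition coarse_inv g : coarse_arrow :=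
  exist _ (sc_map (@pair_inv _ _ _ act) (asc g)) (coarse_inv_subproof g).

Lemma asc_unitE u A :
  sc_sets (asc (coarse_unit u)) A = sc_sets u (@pair_unit _ _ _ act @^-1` A).
Proof. by []. Qed.

Lemma asc_invE g A :
  sc_sets (asc (coarse_inv g)) A = sc_sets (asc g) (@pair_inv _ _ _ act @^-1` A).
Proof. by []. Qed.

Lemma pair_rng_unit u : pair_rng (pair_unit (act := act) u) = u.
Proof. by rewrite pair_rng_of orbit_reprK. Qed.

Lemma pair_src_unit u : pair_src (pair_unit (act := act) u) = u.
Proof. by rewrite pair_src_of orbit_reprK. Qed.

Lemma pair_rng_inv p : pair_rng (pair_inv (act := act) p) = pair_src p.
Proof. by have [x [y ->]] := pair_case p; rewrite pair_inv_of pair_rng_of pair_src_of. Qed.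

Lemma pair_src_inv p : pair_src (pair_inv (act := act) p) = pair_rng p.
Proof. by have [x [y ->]] := pair_case p; rewrite pair_inv_of pair_rng_of pair_src_of. Qed.

Lemma coarse_rng_unit u : coarse_rng (coarse_unit u) = u.
Proof.
apply: sc_eq => A; rewrite coarse_rngE asc_unitE => uA.
by apply: (filterS _ uA) => v /=; rewrite pair_rng_unit.
Qed.

Lemma coarse_src_unit u : coarse_src (coarse_unit u) = u.
Proof.
apply: sc_eq => A; rewrite coarse_srcE asc_unitE => uA.
by apply: (filterS _ uA) => v /=; rewrite pair_src_unit.
Qed.

Lemma coarse_rng_inv g : coarse_rng (coarse_inv g) = coarse_src g.
Proof.
apply: sc_eq => A; rewrite coarse_rngE coarse_srcE asc_invE => uA.
by apply: (filterS _ uA) => v /=; rewrite pair_rng_inv.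
Qed.

Lemma coarse_src_inv g : coarse_src (coarse_inv g) = coarse_rng g.
Proof.
apply: sc_eq => A; rewrite coarse_rngE coarse_srcE asc_invE => uA.
by apply: (filterS _ uA) => v /=; rewrite pair_src_inv.
Qed.

Lemma coarse_rng_mul g h : composable g h ->
  coarse_rng (coarse_mul g h) = coarse_rng g.
Proof.
move=> gh; apply/esym/sc_eq => A; rewrite !coarse_rngE => gA; apply/(coarse_mulE gh).
exists (@pair_rng _ _ _ act @^-1` A), setT; split => //; first exact: filterT.
by move=> k [p [q [Ap _ /pair_mul_ends[_ E _]]]]; rewrite /= E.
Qed.

Lemma coarse_src_mul g h : composable g h ->
  coarse_src (coarse_mul g h) = coarse_src h.
Proof.
move=> gh; apply/esym/sc_eq => A; rewrite !coarse_srcE => hA; apply/(coarse_mulE gh).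
exists setT, (@pair_src _ _ _ act @^-1` A); split => //; first exact: filterT.
by move=> k [p [q [_ Aq /pair_mul_ends[_ _ E]]]]; rewrite /= E.
Qed.

Lemma coarse_mulA g h k : composable g h -> composable h k ->
  coarse_mul g (coarse_mul h k) = coarse_mul (coarse_mul g h) k.
Proof.
move=> gh hk.
have g_hk : composable g (coarse_mul h k) by rewrite /composable coarse_rng_mul.
have gh_k : composable (coarse_mul g h) k by rewrite /composable coarse_src_mul.
apply: coarse_mul_eq => // A E gA /(coarse_mulE hk)[B [C [hB kC BCE]]].
have := coarse_mul_set gh_k (coarse_mul_set gh gA hB) kC.
apply: filterS => m [l [t [[p [q [Ap Bq pql]]] Ct ltm]]].
have [_ _ El] := pair_mul_ends pql; have [Et _ _] := pair_mul_ends ltm.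
have [w qtw] : exists w, pair_mul q t w by apply: pair_mul_ex; rewrite -El.
exists p, w; split=> //; first by apply: BCE; exists q, t.
exact: pair_mulA pql ltm qtw.
Qed.

Lemma coarse_mul1g g : coarse_mul (coarse_unit (coarse_rng g)) g = g.
Proof.
apply: coarse_mul_eq; first by rewrite /composable coarse_src_unit.
move=> A B; rewrite asc_unitE coarse_rngE => gA gB.
apply: (filterS _ (filterI gA gB)) => p [/= Ap Bp].
exists (pair_unit (pair_rng p)), p; split=> //.
have [x [y ->]] := pair_case p.
by rewrite pair_rng_of pair_unit_of; exact: pair_mul_of.
Qed.

Lemma coarse_mulg1 g : coarse_mul g (coarse_unit (coarse_src g)) = g.
Proof.
apply: coarse_mul_eq; first by rewrite /composable coarse_rng_unit.
move=> A B gA; rewrite asc_unitE coarse_srcE => gB.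
apply: (filterS _ (filterI gA gB)) => p [/= Ap Bp].
exists p, (pair_unit (pair_src p)); split=> //.
have [x [y ->]] := pair_case p.
by rewrite pair_src_of pair_unit_of; exact: pair_mul_of.
Qed.

Lemma coarse_mulgV g : coarse_mul g (coarse_inv g) = coarse_unit (coarse_rng g).
Proof.
apply: coarse_mul_eq; first by rewrite /composable coarse_rng_inv.
move=> A B gA; rewrite asc_unitE asc_invE coarse_rngE => gB.
apply: (filterS _ (filterI gA gB)) => p [/= Ap Bp].
exists p, (pair_inv p); split=> //.
have [x [y ->]] := pair_case p.
by rewrite pair_rng_of pair_unit_of pair_inv_of; exact: pair_mul_of.
Qed.

Lemma coarse_mulVg g : coarse_mul (coarse_inv g) g = coarse_unit (coarse_src g).
Proof.
apply: coarse_mul_eq; first by rewrite /composable coarse_src_inv.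
move=> A B; rewrite asc_unitE asc_invE coarse_srcE => gA gB.
apply: (filterS _ (filterI gA gB)) => p [/= Ap Bp].
exists (pair_inv p), p; split=> //.
have [x [y ->]] := pair_case p.
by rewrite pair_src_of pair_unit_of pair_inv_of; exact: pair_mul_of.
Qed.

Lemma coarse_rng_continuous : continuous (@coarse_rng _ _ _ act).
Proof.
move=> g U /sc_nbhsP[A gA AU]; apply/arrow_nbhsP.
by exists (@pair_rng _ _ _ act @^-1` A) => // h hA; exact: AU.
Qed.

Lemma coarse_src_continuous : continuous (@coarse_src _ _ _ act).
Proof.
move=> g U /sc_nbhsP[A gA AU]; apply/arrow_nbhsP.
by exists (@pair_src _ _ _ act @^-1` A) => // h hA; exact: AU.
Qed.

Lemma coarse_unit_continuous : continuous coarse_unit.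
Proof.
move=> u U /arrow_nbhsP[A uA AU]; apply/sc_nbhsP.
by exists (@pair_unit _ _ _ act @^-1` A) => // h hA; exact: AU.
Qed.

Lemma coarse_inv_continuous : continuous coarse_inv.
Proof.
move=> g U /arrow_nbhsP[A gA AU]; apply/arrow_nbhsP.
by exists (@pair_inv _ _ _ act @^-1` A) => // h hA; exact: AU.
Qed.

Lemma coarse_mul_continuous :
  {within [set gh : coarse_arrow * coarse_arrow | coarse_src gh.1 = coarse_rng gh.2],
   continuous (fun gh : coarse_arrow * coarse_arrow => coarse_mul gh.1 gh.2)}.
Proof.
apply/subspace_continuousP => -[g h] /= gh U /arrow_nbhsP[C /coarse_mulE].
move=> /(_ gh)[A [B [gA hB ABC]]] CU.
exists ([set g' | sc_sets (asc g') A], [set h' | sc_sets (asc h') B]).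
  by split; apply/arrow_nbhsP; [exists A|exists B].
move=> [g' h'] [/= gA' hB'] gh'; apply: CU; apply: (filterS ABC).
exact: coarse_mul_set.
Qed.

Lemma arrow_basic_open A : open [set g : coarse_arrow | sc_sets (asc g) A].
Proof.
rewrite openE => g gA; apply/arrow_nbhsP.
by exists A.
Qed.

Lemma coarse_src_local_homeo : local_homeo (@coarse_src _ _ _ act).
Proof.
split; first exact: coarse_src_continuous.
move=> g; have [A gA [Ainj [r r0 Ar]]] := src_inj_piece g.
exists [set h | sc_sets (asc h) A]; first by split=> //; exact: arrow_basic_open.
split=> [h k hA kA E|V oV VA].
  apply: arrow_eq => C hC.
  have : sc_sets (coarse_src h) (@pair_src _ _ _ act @` (C `&` A)).
    by rewrite sc_mapE; apply: (filterS _ (filterI hC hA)) => p; exists p.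
  rewrite E sc_mapE => kC; apply: (filterS _ (filterI kC kA)) => p [[q [Cq Aq] qp] Ap].
  by rewrite -(Ainj _ _ Aq Ap qp).
rewrite openE => _ [h Vh <-].
have hA := VA _ Vh.
have /arrow_nbhsP[B hB BV] : nbhs h V by apply: open_nbhs_nbhs.
apply/sc_nbhsP; exists (@pair_src _ _ _ act @` (A `&` B)).
  by rewrite sc_mapE; apply: (filterS _ (filterI hA hB)) => p; exists p.
move=> u uAB.
have /choice[sec Hsec] (v : D0) : exists p, pair_src p = v /\
    ((@pair_src _ _ _ act @` (A `&` B)) v -> (A `&` B) p).
  have [[p ABp pv]|nv] := pselect ((@pair_src _ _ _ act @` (A `&` B)) v).
    by exists p.
  by exists (pair_unit v); rewrite pair_src_unit; split.
have kAB : sc_sets (sc_map sec u) (A `&` B).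
  rewrite sc_mapE; apply: (filterS _ uAB) => v.
  by have [_] := Hsec v.
have [k kE] : exists k, asc k = sc_map sec u.
  by apply: (arrow_ex r0); apply: (filterS _ kAB) => p [/Ar].
exists k.
  by apply: BV; rewrite kE; apply: (filterS _ kAB) => p [].
apply: sc_eq => C; rewrite coarse_srcE kE => kC.
have uC : sc_sets u [set v | C (pair_src (sec v))] by exact: kC.
apply: (filterS _ uC) => v /=.
by have [-> _] := Hsec v.
Qed.

Lemma coarse_hausdorff : hausdorff_space coarse_arrow.
Proof.
move=> g h clgh; apply: arrow_eq => A gA; apply: contrapT => /sc_setC hA.
have [k [/= kA kA']] := clgh _ _
  (open_nbhs_nbhs (conj (@arrow_basic_open A) gA))
  (open_nbhs_nbhs (conj (@arrow_basic_open (~` A)) hA)).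
exact: sc_not kA kA'.
Qed.

Lemma Delta_compact r : 0 <= r ->
  compact [set g : coarse_arrow | sc_sets (asc g) (Delta r)].
Proof.
move=> r0; rewrite compact_ultra => F uF FD.
have uG : UltraFilter [set A : set D | F [set g | sc_sets (asc g) A]].
  apply: ultra_prime.
    apply: Build_ProperFilter_ex.
      move=> A FA.
      have /filter_ex[g /= gA] : F [set g | sc_sets (asc g) A] by exact: FA.
      exact: filter_ex gA.
    split.
    - have FT : F setT by exact: filterT.
      by apply: (filterS _ FT) => g _; exact: filterT.
    - move=> A B FA FB.
      by apply: (@filterS _ F _ _ _ _ (@filterI _ F _ _ _ FA FB)) => g [gA gB];
         exact: filterI.
    - by move=> A B AB FA; apply: (@filterS _ F _ _ _ _ FA) => g; exact: filterS.
  move=> A /=; have [|FA] := @in_ultra_setVsetC _ F [set g | sc_sets (asc g) A] _.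
    by left.
  by right; apply: (filterS _ FA) => g; exact: sc_setC.
have [k kE] : exists k, asc k = StoneCech uG by exact: arrow_ex r0 _.
exists k; split; first by rewrite /= kE.
move=> U /arrow_nbhsP[A]; rewrite kE /= => FA AU.
by apply: (filterS _ FA) => g; exact: AU.
Qed.

Lemma coarse_locally_compact : locally_compact [set: coarse_arrow].
Proof.
move=> g _; have [r r0 gr] := arrow_bounded g.
exists [set h | sc_sets (asc h) (Delta r)].
  apply/arrow_nbhsP; exists (Delta r) => // h hr _; exact: hr.
split; first exact: Delta_compact.
apply: compact_closed; first exact: coarse_hausdorff.
exact: Delta_compact.
Qed.

Definition coarse_groupoid : etaleGroupoid :=
  EtaleGroupoid coarse_rng_unit coarse_src_unit coarse_rng_inv coarse_src_inv
    coarse_rng_mul coarse_src_mul coarse_mulA coarse_mul1g coarse_mulg1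
    coarse_mulgV coarse_mulVg coarse_rng_continuous coarse_unit_continuous
    coarse_inv_continuous coarse_mul_continuous coarse_src_local_homeo
    coarse_hausdorff coarse_locally_compact.

End CoarseGroupoid.

(* Main.v *)
(** The arrows of the groupoid are ultrafilters on the orbits of pairs, so a
    function on [(X x X)/Gam] that is bounded on every [Delta_r/Gam] extends
    continuously to [G(X, Gam)] by taking limits along ultrafilters; conversely a
    continuous function on the groupoid restricts to a [Gam]-invariant kernel on
    [X]. This matches proper conditionally negative definite functions on the
    groupoid with [Gam]-invariant conditionally negative definite kernels [k] on
    [X] that are bounded on each [Delta_r] and have sublevel sets inside some
    [Delta_r].

    An equivariant embedding [f] gives [k(x,y) = |f x - f y|^2]. Conversely [k]
    gives the positive definite kernel
    [K(x,y) = (k(x,x0) + k(y,x0) - k(x,y))/2], and [f x = K(x,.)] embeds [X] in the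
    reproducing kernel Hilbert space of [K]. Working with this space of functions,
    rather than with an abstract completion, makes completeness a matter of
    pointwise limits and gives the affine action of [Gam] by translation of
    functions. *)

From HB Require Import structures.
Require Import Defs.
From mathcomp Require Import all_boot all_order all_algebra.
From mathcomp Require Import all_classical all_reals all_analysis.
From mathcomp Require Import ring lra.

Set Implicit Arguments.
Unset Strict Implicit.
Unset Printing Implicit Defensive.

Import Order.TTheory GRing.Theory Num.Theory.
Import numFieldNormedType.Exports.

Local Open Scope classical_set_scope.
Local Open Scope ring_scope.

(** * The inner product of a norm satisfying the parallelogram law *)

(* The defect [g a - a g 1] is 1-periodic, hence bounded, and additive, hence 0. *)
Lemma additive_bounded_linear (R : realType) (g : R -> R) (M : R) :
  {morph g : a b / a + b} -> (forall a, 0 <= a < 1 -> `|g a| <= M) ->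
  forall a, g a = a * g 1.
Proof.
move=> gD gM.
pose e a := g a - a * g 1.
have eD : {morph e : a b / a + b} by move=> a b; rewrite /e gD; ring.
have e0 : e 0 = 0 by have := eD 0 0; rewrite addr0; lra.
have eMn a n : e (a *+ n) = e a *+ n.
  by elim: n => [|n IHn]; rewrite ?mulr0n // !mulrS eD IHn.
have eN a : e (- a) = - e a by have := eD a (- a); rewrite subrr e0; lra.
have eint (z : int) : e z%:~R = 0.
  have en (n : nat) : e n%:R = 0 by rewrite eMn /e mul1r subrr mul0rn.
  by case: z => n; rewrite ?NegzE ?rmorphN /= ?eN -pmulrn en ?oppr0.
pose C := M + `|g 1|.
have eC a : `|e a| <= C.
  have -> : e a = e (a - (Num.floor a)%:~R) by rewrite eD eN eint subr0.
  set b := a - _; have /andP[b0 b1] : 0 <= b < 1.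
    have := floor_itv a; rewrite intrD1 /b; move: (Num.floor a)%:~R => z; lra.
  rewrite (le_trans (ler_normB _ _)) // lerD //; first by rewrite gM ?b0.
  by rewrite normrM ler_piMl // ger0_norm // ltW.
move=> a; apply/eqP; rewrite -subr_eq0 -/(e a) -normr_le0; apply/negPn/negP.
rewrite -ltNge => ea.
(* Archimedean step: for this multiple [n], [n * |e a|] exceeds the bound [C]. *)
have := eC (a *+ (Num.truncn (C / `|e a|)).+1).
rewrite eMn normrMn -mulr_natr mulrC -ler_pdivlMr //.
by rewrite leNgt truncnS_gt.
Qed.

Section JordanVonNeumann.
Variables (R : realType) (V : normedModType R).
Hypothesis parallelogram : forall u v : V,
  `|u + v| ^+ 2 + `|u - v| ^+ 2 = 2 * (`|u| ^+ 2 + `|v| ^+ 2).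

Definition polar (u v : V) : R := (`|u + v| ^+ 2 - `|u - v| ^+ 2) / 4.

Lemma polarC u v : polar u v = polar v u.
Proof. by rewrite /polar (addrC u) (distrC u). Qed.

Lemma polar_norm u : polar u u = `|u| ^+ 2.
Proof.
have := parallelogram u u; rewrite /polar subrr normr0 expr0n /=.
by move: (`|u + u| ^+ 2) (`|u| ^+ 2) => a b; lra.
Qed.

(** Subtracting the parallelogram laws at [(x + z, y + z)] and [(x - z, y - z)] gives [half]. Its
    right side sees [x] and [y] only through [x + y], so [(u, v)] may be replaced by
    [(u + v, 0)]. *)
Lemma polarD u v w : polar (u + v) w = polar u w + polar v w.
Proof.
have polar0 z : polar 0 z = 0 by rewrite /polar add0r sub0r normrN subrr mul0r.
have half x y z : polar x z + polar y z = polar (x + y) (z *+ 2) / 2.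
  have H1 := parallelogram (x + z) (y + z).
  have H2 := parallelogram (x - z) (y - z).
  have E1 : x + z + (y + z) = x + y + z *+ 2 by rewrite addrACA mulr2n.
  have E2 : x - z + (y - z) = x + y - z *+ 2 by rewrite addrACA mulr2n opprD.
  have E3 : x + z - (y + z) = x - y by rewrite opprD addrACA subrr addr0.
  have E4 : x - z - (y - z) = x - y by rewrite opprB addrA subrK.
  move: H1 H2; rewrite /polar E1 E2 E3 E4.
  do ![move: (`|_| ^+ 2) => ?]; lra.
by rewrite half (_ : polar _ w = polar (u + v) w + polar 0 w)
  ?polar0 ?addr0 // -[LHS]addr0 -(polar0 w) half addr0.
Qed.

(** The map [b |-> polar (b *: u) v] is additive and, by the parallelogram law, bounded for
    [0 <= b < 1], hence linear. *)
Lemma polarZ a u v : polar (a *: u) v = a * polar u v.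
Proof.
have H := @additive_bounded_linear R (fun b => polar (b *: u) v)
  (`|u| ^+ 2 + `|v| ^+ 2).
have {H} -> := H _ _ a; rewrite ?scale1r //.
  by move=> b c; rewrite scalerDl polarD.
move=> b /andP[b0 b1].
have := parallelogram (b *: u) v; rewrite normrZ (ger0_norm b0) /polar.
move: (sqr_ge0 `|b *: u + v|) (sqr_ge0 `|b *: u - v|) (sqr_ge0 `|v|).
have : (b * `|u|) ^+ 2 <= `|u| ^+ 2.
  by rewrite exprMn ler_piMl // expr_le1 // ltW.
move=> ? ? ? ? ?; rewrite ler_norml; apply/andP; split; lra.
Qed.

Lemma polar_linear a u v w : polar (a *: u + v) w = a * polar u w + polar v w.
Proof. by rewrite polarD polarZ. Qed.

End JordanVonNeumann.

Definition hilbert_of_parallelogram (R : realType) (V : completeNormedModType R)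
    (pV : forall u v : V,
      `|u + v| ^+ 2 + `|u - v| ^+ 2 = 2 * (`|u| ^+ 2 + `|v| ^+ 2)) :
    hilbertSpace R :=
  HilbertSpace (@polarC R V) (polar_linear pV) (polar_norm pV).

(** * Reproducing kernel Hilbert spaces *)

Section Combinations.
Variables (R : realType) (X : Type).
Implicit Types (h g : X -> R^o) (s t : seq (R * X)).

(** A list encodes a formal sum of weighted point masses, repetitions allowed, so that addition is
    [++]; [pairing] integrates [h] against it. *)
Definition pairing h s : R := \sum_(p <- s) p.1 * h p.2.

Definition scale_comb (a : R) s := [seq (a * p.1, p.2) | p <- s].

Lemma pairing_nil h : pairing h [::] = 0.
Proof. exact: big_nil. Qed.

Lemma pairing_cons h p s : pairing h (p :: s) = p.1 * h p.2 + pairing h s.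
Proof. exact: big_cons. Qed.

Lemma pairing_cat h s t : pairing h (s ++ t) = pairing h s + pairing h t.
Proof. by rewrite /pairing big_cat. Qed.

Lemma pairing_scale h a s : pairing h (scale_comb a s) = a * pairing h s.
Proof.
by rewrite /pairing big_map mulr_sumr; apply: eq_bigr => p _; rewrite mulrA.
Qed.

Lemma pairing1 h x : pairing h [:: (1, x)] = h x.
Proof. by rewrite /pairing big_seq1 mul1r. Qed.

Lemma pairing_linear s a h g :
  pairing (a *: h + g) s = a * pairing h s + pairing g s.
Proof.
rewrite /pairing mulr_sumr -big_split; apply: eq_bigr => p _ /=.
by rewrite mulrDr mulrCA.
Qed.

Lemma pairingB h g s : pairing (h - g) s = pairing h s - pairing g s.
Proof. by rewrite addrC -scaleN1r pairing_linear mulN1r addrC. Qed.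

Lemma pairingD h g s : pairing (h + g) s = pairing h s + pairing g s.
Proof. by rewrite -[h in LHS]scale1r pairing_linear mul1r. Qed.

Lemma pairing_cvg (T : Type) (F : set_system T) (u : T -> X -> R^o) h s :
  Filter F -> (forall x, u i x @[i --> F] --> h x) ->
  pairing (u i) s @[i --> F] --> pairing h s.
Proof.
move=> FF uh; rewrite /pairing.
elim: s => [|p s IHs].
  by under eq_fun do rewrite big_nil; rewrite big_nil; exact: cvg_cst.
under eq_fun do rewrite big_cons; rewrite big_cons.
by apply: cvgD => //; apply: cvgM; [exact: cvg_cst|exact: uh].
Qed.

End Combinations.

Definition kform (R : realType) (X : Type) (K : X -> X -> R^o) s t : R :=
  pairing (fun x => pairing (K x) t) s.

Record psdKernel (R : realType) (X : Type) := PsdKernel {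
  kern :> X -> X -> R^o;
  kern_sym : forall x y, kern x y = kern y x;
  kern_ge0 : forall s, 0 <= kform kern s s
}.

Section Rkhs.
Variables (R : realType) (X : Type) (K : psdKernel R X).
Implicit Types (h g : X -> R^o) (s t : seq (R * X)).
Local Notation Q s := (kform K s s).

Lemma kformC s t : kform K s t = kform K t s.
Proof.
rewrite /kform /pairing.
under eq_bigr do rewrite mulr_sumr.
rewrite exchange_big; apply: eq_bigr => p _; rewrite mulr_sumr.
by apply: eq_bigr => q _ /=; rewrite kern_sym mulrCA.
Qed.

Lemma kform_catr s t t' : kform K s (t ++ t') = kform K s t + kform K s t'.
Proof. by rewrite ![kform K s _]kformC /kform pairing_cat. Qed.

Lemma kform_catl s t t' : kform K (t ++ t') s = kform K t s + kform K t' s.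
Proof. by rewrite /kform pairing_cat. Qed.

Lemma kform_scalel a s t : kform K (scale_comb a s) t = a * kform K s t.
Proof. by rewrite /kform pairing_scale. Qed.

Lemma kform_scaler a s t : kform K s (scale_comb a t) = a * kform K s t.
Proof. by rewrite kformC kform_scalel kformC. Qed.

Lemma kform_scale a s : Q (scale_comb a s) = a ^+ 2 * Q s.
Proof. by rewrite kform_scalel kform_scaler mulrA. Qed.

(* [energy h] is the squared norm of [h]; as a supremum of affine functions of
   [h] it gives the parallelogram law directly. *)
Definition energy_values h : set R := [set 2 * pairing h s - Q s | s in setT].

Definition energy h : R := sup (energy_values h).

(** For [C >= 0]: the functional [pairing h] has norm at most [sqrt C] for the seminorm given by
    [kform K]. The functions with such a bound form the reproducing kernel Hilbert space. *)
Definition dominated (C : R) h := forall s, pairing h s ^+ 2 <= C * Q s.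

(** With [p = pairing h s] and [q = Q s], rescaling [s] by [a] turns the bound on the supremum into
    [2 a p - a^2 q <= C] for all [a]; for [q > 0] the maximum over [a] is [p^2 / q]. *)
Lemma dominatedP C h : 0 <= C -> dominated C h <-> ubound (energy_values h) C.
Proof.
move=> C0; split=> [hC _ [s _ <-]|hC s].
  have Q0 := kern_ge0 K s.
  have : pairing h s <= Num.sqrt (C * Q s).
    by rewrite (le_trans (ler_norm _)) // -sqrtr_sqr ler_wsqrtr.
  rewrite sqrtrM // => hs.
  (* AM-GM: [2 sqrt (C q) <= C + q] *)
  have := sqr_ge0 (Num.sqrt C - Num.sqrt (Q s)).
  rewrite sqrrB !sqr_sqrtr // -mulr_natl => ?; lra.
have Q0 := kern_ge0 K s.
have H a : 2 * a * pairing h s - a ^+ 2 * Q s <= C.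
  by rewrite -mulrA -pairing_scale -kform_scale; apply: hC; exists (scale_comb a s).
have [Qs|Qs] := eqVneq (Q s) 0.
  have [->|hs] := eqVneq (pairing h s) 0; first by rewrite expr0n mulr_ge0.
  (* When [Q s = 0] the bound is linear in the scaling factor, and this factor gives the value
     [C + 1]. *)
  have := H ((C + 1) / (2 * pairing h s)).
  have -> : 2 * ((C + 1) / (2 * pairing h s)) * pairing h s = C + 1 by field.
  by rewrite Qs mulr0; lra.
have {}Q0 : 0 < Q s by rewrite lt_def Qs.
have := H (pairing h s / Q s).
have -> : 2 * (pairing h s / Q s) * pairing h s - (pairing h s / Q s) ^+ 2 * Q s =
  pairing h s ^+ 2 / Q s by field.
by rewrite ler_pdivrMr.
Qed.

Definition rkhs_pred : {pred X -> R^o} := fun h => `[< exists C, dominated C h >].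

Lemma rkhs_predP h : reflect (exists2 C, 0 <= C & dominated C h) (h \in rkhs_pred).
Proof.
apply: (iffP (asboolP _)) => [[C hC]|[C _ hC]]; last by exists C.
exists `|C| => // s; apply: le_trans (hC s) _.
by rewrite ler_wpM2r ?kern_ge0 // ler_norm.
Qed.

Lemma energy_values_neq0 h : energy_values h !=set0.
Proof. by exists (2 * pairing h [::] - Q [::]), [::]. Qed.

Lemma energy_ge0 h : h \in rkhs_pred -> 0 <= energy h.
Proof.
move=> /rkhs_predP[C C0 /(dominatedP _ C0) hC]; apply: ub_le_sup; first by exists C.
by exists [::] => //; rewrite /kform /pairing !big_nil mulr0 subr0.
Qed.

Lemma energy_dominated h : h \in rkhs_pred -> dominated (energy h) h.
Proof.
move=> hH; apply/dominatedP; first exact: energy_ge0.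
move/rkhs_predP: hH => [C C0 /(dominatedP _ C0) hC].
by apply: sup_upper_bound; split; [exact: energy_values_neq0|exists C].
Qed.

Lemma energy_le C h : 0 <= C -> dominated C h -> energy h <= C.
Proof.
move=> C0 /(dominatedP _ C0) hC; apply: ge_sup => //; exact: energy_values_neq0.
Qed.

Lemma pairing_le h s : h \in rkhs_pred ->
  `|pairing h s| <= Num.sqrt (energy h) * Num.sqrt (Q s).
Proof.
move=> hH; rewrite -sqrtrM ?energy_ge0 // -sqrtr_sqr ler_wsqrtr //.
exact: energy_dominated.
Qed.

Lemma pairing_dominated h c : 0 <= c ->
  (forall s, `|pairing h s| <= c * Num.sqrt (Q s)) -> dominated (c ^+ 2) h.
Proof.
move=> c0 hc s; rewrite -[leLHS]real_normK ?num_real //.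
by rewrite -[Q s]sqr_sqrtr ?kern_ge0 // -exprMn lerXn2r ?nnegrE ?mulr_ge0 ?sqrtr_ge0.
Qed.

Lemma sqrt_energy_le h c : 0 <= c ->
  (forall s, `|pairing h s| <= c * Num.sqrt (Q s)) -> Num.sqrt (energy h) <= c.
Proof.
move=> c0 hc; rewrite -(ger0_norm c0) -sqrtr_sqr ler_wsqrtr //.
by apply: energy_le; [exact: sqr_ge0|exact: pairing_dominated].
Qed.

Lemma pairing_sum_le a h g s : h \in rkhs_pred -> g \in rkhs_pred ->
  `|pairing (a *: h + g) s| <=
  (`|a| * Num.sqrt (energy h) + Num.sqrt (energy g)) * Num.sqrt (Q s).
Proof.
move=> hH gH; rewrite pairing_linear (le_trans (ler_normD _ _)) // mulrDl lerD //.
  by rewrite normrM -mulrA ler_wpM2l // pairing_le.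
exact: pairing_le.
Qed.

Lemma rkhs_submod_closed : submod_closed rkhs_pred.
Proof.
split=> [|a h g hH gH].
  apply/rkhs_predP; exists 0 => // s.
  by rewrite /pairing big1 ?expr0n ?mul0r // => p _; rewrite mulr0.
pose c := `|a| * Num.sqrt (energy h) + Num.sqrt (energy g).
have c0 : 0 <= c by rewrite addr_ge0 ?mulr_ge0 ?sqrtr_ge0.
apply/rkhs_predP; exists (c ^+ 2); first exact: sqr_ge0.
by apply: (pairing_dominated c0) => s; apply: pairing_sum_le.
Qed.

HB.instance Definition _ :=
  GRing.isSubmodClosed.Build R (X -> R^o) rkhs_pred rkhs_submod_closed.

Record rkhs := Rkhs { rkhs_fun :> X -> R^o; rkhs_fun_in : rkhs_fun \in rkhs_pred }.

HB.instance Definition _ := [isSub for rkhs_fun].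
HB.instance Definition _ := [Choice of rkhs by <:].
HB.instance Definition _ := [SubChoice_isSubLmodule of rkhs by <:].

Implicit Types u v w : rkhs.

Definition rkhs_norm u : R := Num.sqrt (energy u).

Lemma rkhs_linearE a u v :
  (a *: u + v : rkhs) = a *: (u : X -> R^o) + (v : X -> R^o) :> (X -> R^o).
Proof. by []. Qed.

Lemma rkhs_norm_linear a u v :
  rkhs_norm (a *: u + v) <= `|a| * rkhs_norm u + rkhs_norm v.
Proof.
apply: sqrt_energy_le => [|s]; first by rewrite addr_ge0 ?mulr_ge0 ?sqrtr_ge0.
by rewrite rkhs_linearE; apply: pairing_sum_le; exact: rkhs_fun_in.
Qed.

Lemma rkhs_normD u v : rkhs_norm (u + v) <= rkhs_norm u + rkhs_norm v.
Proof. by have := rkhs_norm_linear 1 u v; rewrite scale1r normr1 mul1r. Qed.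

(** Evaluation at [x] is the pairing with the point mass at [x], so it is bounded by a multiple of
    the norm. *)
Lemma rkhs_norm_eq0 u : rkhs_norm u = 0 -> u = 0.
Proof.
move=> u0; apply/val_inj/funext => x /=.
have := pairing_le [:: (1, x)] (rkhs_fun_in u).
by rewrite -/(rkhs_norm u) u0 mul0r pairing1 normr_le0 => /eqP.
Qed.

Lemma rkhs_norm0 : rkhs_norm 0 = 0.
Proof.
apply/eqP; rewrite eq_le sqrtr_ge0 andbT; apply: sqrt_energy_le => // s.
by rewrite /pairing big1 ?normr0 ?mul0r // => p _; rewrite mulr0.
Qed.

Lemma rkhs_normZ a u : rkhs_norm (a *: u) = `|a| * rkhs_norm u.
Proof.
have le b v : rkhs_norm (b *: v) <= `|b| * rkhs_norm v.
  by have := rkhs_norm_linear b v 0; rewrite addr0 rkhs_norm0 addr0.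
have [->|a0] := eqVneq a 0; first by rewrite scale0r normr0 mul0r rkhs_norm0.
apply/eqP; rewrite eq_le le /=.
have := le a^-1 (a *: u); rewrite scalerA mulVf // scale1r normfV.
by rewrite ler_pdivlMl ?normr_gt0.
Qed.

HB.instance Definition _ :=
  Lmodule_isNormed.Build R rkhs rkhs_normD rkhs_normZ rkhs_norm_eq0.

Lemma rkhs_normE u : `|u| = Num.sqrt (energy u).
Proof. by []. Qed.

End Rkhs.

(** * Parallelogram law, completeness and the points of the kernel space *)

Section RkhsHilbert.
Variables (R : realType) (X : Type) (K : psdKernel R X).
Implicit Types (h g : X -> R^o) (s t : seq (R * X)) (u v w : rkhs K).
Local Notation Q s := (kform K s s).

Lemma rkhs_norm_sqr u : `|u| ^+ 2 = energy K u.
Proof. by rewrite rkhs_normE sqr_sqrtr // energy_ge0 // rkhs_fun_in. Qed.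

Lemma rkhs_pairing_le u s : `|pairing u s| <= `|u| * Num.sqrt (Q s).
Proof. by apply: pairing_le; exact: rkhs_fun_in. Qed.

Lemma energy_value_le u s : 2 * pairing u s - Q s <= `|u| ^+ 2.
Proof.
rewrite rkhs_norm_sqr; have uH := rkhs_fun_in u.
have /(dominatedP _ _ (energy_ge0 uH)) := energy_dominated uH.
by apply; exists s.
Qed.

(* The supremum defining the energy is evaluated at [(s + t)/2] and [(s - t)/2]. *)
Lemma rkhs_parallelogram_le u v :
  `|u + v| ^+ 2 + `|u - v| ^+ 2 <= 2 * (`|u| ^+ 2 + `|v| ^+ 2).
Proof.
rewrite -lerBrDl [leLHS]rkhs_norm_sqr; apply: ge_sup.
  exact: energy_values_neq0.
move=> _ [t _ <-]; rewrite lerBrDl -lerBrDr rkhs_norm_sqr; apply: ge_sup.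
  exact: energy_values_neq0.
move=> _ [s _ <-].
have := energy_value_le u (scale_comb 2^-1 (s ++ t)).
have := energy_value_le v (scale_comb 2^-1 (s ++ scale_comb (-1) t)).
rewrite [pairing (u + v) s]pairingD [pairing (u - v) t]pairingB.
rewrite !(kform_scale, pairing_scale, pairing_cat).
rewrite !(kform_catl, kform_catr, kform_scalel, kform_scaler) (kformC K t s).
move: (`|u| ^+ 2) (`|v| ^+ 2) => nu nv; lra.
Qed.

(** The inequality just proved, applied to [u + v] and [u - v], is its own converse. *)
Lemma rkhs_parallelogram u v :
  `|u + v| ^+ 2 + `|u - v| ^+ 2 = 2 * (`|u| ^+ 2 + `|v| ^+ 2).
Proof.
apply/eqP; rewrite eq_le rkhs_parallelogram_le /=.
have := rkhs_parallelogram_le (u + v) (u - v).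
have -> : u + v + (u - v) = 2 *: u by rewrite addrACA subrr addr0 scaler_nat mulr2n.
have -> : u + v - (u - v) = 2 *: v.
  by rewrite opprB addrC addrA subrK scaler_nat mulr2n.
rewrite !normrZ !exprMn ger0_norm //.
move: (`|u + v| ^+ 2) (`|u - v| ^+ 2) (`|u| ^+ 2) (`|v| ^+ 2) => a b c d; lra.
Qed.

Lemma rkhs_ball_pairing u v e s : ball u e v ->
  `|pairing u s - pairing v s| <= e * Num.sqrt (Q s).
Proof.
rewrite -ball_normE /= => /ltW uv.
have := rkhs_pairing_le (u - v) s; rewrite [pairing _ _]pairingB => /le_trans.
by apply; rewrite ler_wpM2r ?sqrtr_ge0.
Qed.

(* A Cauchy filter converges pointwise, since evaluations are bounded, and its
   pointwise limit is also its limit in norm. *)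
Lemma rkhs_cauchy_cvg (F : set_system (rkhs K)) :
  ProperFilter F -> cauchy F -> cvg F.
Proof.
move=> FF /cauchyP Fc.
have Fx x : cvg ((fun u : rkhs K => (u : X -> R^o) x) @ F).
  apply: cauchy_cvg; apply/cauchyP => e e0 /=.
  (* [q] bounds the norm of evaluation at [x]; the radius uses [q + 1] because [q] may be 0. *)
  pose q := Num.sqrt (Q [:: (1, x)]); have q0 : 0 <= q by exact: sqrtr_ge0.
  have [|u Fu] := Fc (e / (q + 1)); first by rewrite divr_gt0 // ltr_wpDl.
  exists (u x); apply: filterS Fu => v /(rkhs_ball_pairing [:: (1, x)]) /=.
  rewrite !pairing1 -ball_normE /= => /le_lt_trans; apply.
  rewrite -/q -mulrA gtr_pMr // mulrC ltr_pdivrMr ?ltr_wpDl // mul1r ltrDl //.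
pose h : X -> R^o := fun x => lim ((fun u : rkhs K => (u : X -> R^o) x) @ F).
have Fs s : (fun u : rkhs K => pairing u s) @ F --> pairing h s.
  by apply: pairing_cvg => x; exact: Fx.
have Fh e u : F (ball u e) -> 0 < e ->
    forall s, `|pairing (h - (u : X -> R^o)) s| <= e * Num.sqrt (Q s).
  move=> Fu e0 s.
  rewrite pairingB.
  have us : (fun v : rkhs K => `|pairing v s - pairing u s|) @ F -->
      `|pairing h s - pairing u s|.
    by apply: cvg_norm; apply: cvgB; [exact: Fs|exact: cvg_cst].
  apply: (cvgr_to_le us).
  by apply: filterS Fu => v /(rkhs_ball_pairing s); rewrite distrC.
(* The limit differs from a single member [u] of the space by a dominated function. *)
have hH : h \in rkhs_pred K.
  have [u Fu] := Fc 1 ltr01.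
  have /pairing_dominated := Fh _ _ Fu ltr01; move=> /(_ ler01) hu.
  rewrite -[h](subrK (u : X -> R^o)); apply: rpredD; last exact: rkhs_fun_in.
  by apply/rkhs_predP; exists (1 ^+ 2).
apply/cvg_ex; exists (Rkhs hH : rkhs K).
apply/cvgrPdist_le => e e0.
have e20 : 0 < e / 2 by rewrite divr_gt0.
have [u Fu] := Fc _ e20; have := Fh _ _ Fu e20.
move=> /(sqrt_energy_le (ltW e20)).
rewrite -[energy _ _]/(energy K (Rkhs hH - u)) -rkhs_normE => hu.
apply: filterS Fu => v; rewrite -ball_normE /= => /ltW uv.
by rewrite (le_trans (ler_distD u _ _)) // (splitr e) lerD.
Qed.

HB.instance Definition _ := Uniform_isComplete.Build (rkhs K) rkhs_cauchy_cvg.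

Definition rkhs_hilbert : hilbertSpace R := hilbert_of_parallelogram rkhs_parallelogram.

(** Positivity of the kernel on [s - t] reads [2 * kform K s t - Q t <= Q s]. *)
Lemma kform_dominated h s : (forall t, pairing h t = kform K s t) ->
  dominated K (Q s) h.
Proof.
move=> hs; apply/dominatedP => [|_ [t _ <-]]; first exact: kern_ge0.
have := kern_ge0 K (s ++ scale_comb (-1) t).
rewrite !(kform_catl, kform_catr, kform_scalel, kform_scaler) (kformC K t s) hs; lra.
Qed.

(** The supremum defining the energy of [u] is attained at [s], where its value is
    [2 * Q s - Q s]. *)
Lemma rkhs_norm_kform u s : (forall t, pairing u t = kform K s t) -> `|u| ^+ 2 = Q s.
Proof.
move=> us; apply/eqP; rewrite eq_le; apply/andP; split; last first.
  by apply: le_trans (energy_value_le u s); rewrite us; lra.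
rewrite rkhs_norm_sqr; apply: energy_le; first exact: kern_ge0.
exact: kform_dominated.
Qed.

Lemma kform_sect x t : pairing (K x) t = kform K [:: (1, x)] t.
Proof. by rewrite /kform pairing1. Qed.

Lemma rkhs_point_in x : (K x : X -> R^o) \in rkhs_pred K.
Proof.
apply/rkhs_predP; eexists; first exact: (kern_ge0 K [:: (1, x)]).
by apply: kform_dominated; exact: kform_sect.
Qed.

Definition rkhs_point x : rkhs K := Rkhs (rkhs_point_in x).

Lemma rkhs_point_dist x y :
  `|rkhs_point x - rkhs_point y| ^+ 2 = K x x - 2 * K x y + K y y.
Proof.
rewrite (rkhs_norm_kform (s := [:: (-1, y); (1, x)])) => [|t].
  rewrite /kform /pairing !(big_cons, big_nil) /= (kern_sym K y x); ring.
rewrite [LHS]pairingB !kform_sect -[- _]mulN1r -kform_scalel addrC -kform_catl.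
by rewrite /= mulr1.
Qed.

End RkhsHilbert.

(** * Invariant conditionally negative definite kernels *)

Definition cnd_kernel (R : realType) (X : Type) (k : X -> X -> R^o) : Prop :=
  [/\ forall x y, k x y = k y x, forall x, k x x = 0 &
      forall s : seq (R * X), pairing (fun=> 1) s = 0 -> kform k s s <= 0].

Lemma cnd_kernel_ge0 (R : realType) (X : Type) (k : X -> X -> R^o) x y :
  cnd_kernel k -> 0 <= k x y.
Proof.
move=> [kC k0 kneg]; have := kneg [:: (1, x); (-1, y)].
rewrite /kform !(pairing_cons, pairing_nil) /= !k0 (kC y x) => kxy.
have : 1 * 1 + (-1 * 1 + 0) = 0 :> R by ring.
by move=> /kxy; lra.
Qed.

Section BasedKernel.
Variables (R : realType) (X : Type) (k : X -> X -> R^o) (x0 : X).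
Hypothesis k_cnd : cnd_kernel k.
Implicit Types s t : seq (R * X).

Local Notation mass s := (pairing (fun=> 1 : R^o) s).

Definition based x y : R^o := (k x x0 + k y x0 - k x y) / 2.

(** A compensating mass at [x0] makes the total mass 0; [based] does not notice it, since it
    vanishes at [x0]. *)
Definition balance s := (- mass s, x0) :: s.

Lemma based_sym x y : based x y = based y x.
Proof. by have [kC _ _] := k_cnd; rewrite /based (kC y x); congr (_ / _); ring. Qed.

Lemma based0l y : based x0 y = 0.
Proof. by have [kC k0 _] := k_cnd; rewrite /based k0 (kC y); ring. Qed.

Lemma based0r x : based x x0 = 0.
Proof. by rewrite based_sym based0l. Qed.

Lemma mass_balance s : mass (balance s) = 0.
Proof. by rewrite pairing_cons /= mulr1 addNr. Qed.

Lemma pairing_balance (h : X -> R^o) s :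
  pairing h (balance s) = pairing h s - mass s * h x0.
Proof. by rewrite pairing_cons /= mulNr addrC. Qed.

Lemma kform_balance s : kform based (balance s) (balance s) = kform based s s.
Proof.
have E x t : pairing (based x) (balance t) = pairing (based x) t.
  by rewrite pairing_balance based0r mulr0 subr0.
rewrite /kform pairing_balance [X in _ - _ * X](_ : _ = 0) ?mulr0 ?subr0.
  by rewrite /pairing; apply: eq_bigr => p _; congr (_ * _); exact: E.
by rewrite /pairing big1 // => p _; rewrite based0l mulr0.
Qed.

Lemma pairing_based x t : pairing (based x) t =
  (mass t * k x x0 + pairing (k^~ x0) t - pairing (k x) t) / 2.
Proof.
elim: t => [|q t IHt]; rewrite !(pairing_nil, pairing_cons); first by ring.
by rewrite IHt /based; field.
Qed.

Lemma kform_based s t : kform based s t =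
  (mass t * pairing (k^~ x0) s + mass s * pairing (k^~ x0) t - kform k s t) / 2.
Proof.
rewrite /kform; elim: s => [|p s IHs]; rewrite !(pairing_nil, pairing_cons).
  by ring.
by rewrite IHs pairing_based; field.
Qed.

(** On combinations of mass 0 the form of [based] is [-1/2] times that of [k], and balancing reduces
    to this case. *)
Lemma based_ge0 s : 0 <= kform based s s.
Proof.
have [_ _ kneg] := k_cnd; have := kneg _ (mass_balance s).
rewrite -kform_balance kform_based mass_balance; lra.
Qed.

Definition based_kernel : psdKernel R X := PsdKernel based_sym based_ge0.

Lemma based_point_dist x y :
  `|rkhs_point based_kernel x - rkhs_point based_kernel y| ^+ 2 = k x y.
Proof.
by have [_ k0 _] := k_cnd; rewrite rkhs_point_dist /= /based !k0; field.
Qed.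

(** * The affine isometric action by translation of functions *)

Variables (Gam : groupType) (act : rightAction Gam X).
Hypothesis k_inv : forall a x y, k (act x a) (act y a) = k x y.

Definition translate (a : Gam) s := [seq (p.1, act p.2 a) | p <- s].

Lemma pairing_translate (h : X -> R^o) a s :
  pairing h (translate a s) = pairing (fun y => h (act y a)) s.
Proof. by rewrite /pairing big_map. Qed.

Lemma kform_translate a s : kform k (translate a s) (translate a s) = kform k s s.
Proof.
rewrite /kform pairing_translate; apply: eq_bigr => p _; congr (_ * _).
by rewrite pairing_translate; apply: eq_bigr => q _; rewrite k_inv.
Qed.

Definition shift_comb a s := translate a^-1 (balance s).

(** Both combinations can be taken of mass 0, where the form is that of the invariant kernel [k] up
    to the factor [-1/2]. *)
Lemma kform_shift a s :
  kform based (shift_comb a s) (shift_comb a s) = kform based s s.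
Proof.
have m0 : mass (shift_comb a s) = 0 by rewrite pairing_translate mass_balance.
by rewrite -[RHS]kform_balance !kform_based m0 mass_balance kform_translate !mul0r.
Qed.

(** Functions in the space vanish at [x0]; subtracting a constant restores this after
    translation. *)
Definition shift_fun a (h : X -> R^o) : X -> R^o :=
  fun y => h (act y a^-1%g) - h (act x0 a^-1%g).

Lemma pairing_shift a h s : pairing (shift_fun a h) s = pairing h (shift_comb a s).
Proof.
rewrite pairing_translate pairing_balance /pairing mulr_suml -sumrB.
by apply: eq_bigr => p _; rewrite mulr1 mulrBr.
Qed.

Lemma shift_dominated a h C :
  dominated based_kernel C h -> dominated based_kernel C (shift_fun a h).
Proof. by move=> hC s; rewrite pairing_shift -(kform_shift a); exact: hC. Qed.

Lemma shift_in a (u : rkhs based_kernel) : shift_fun a u \in rkhs_pred based_kernel.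
Proof.
have /rkhs_predP[C C0 uC] := rkhs_fun_in u.
by apply/rkhs_predP; exists C => //; exact: shift_dominated.
Qed.

Definition shift a (u : rkhs based_kernel) : rkhs based_kernel := Rkhs (shift_in a u).

Lemma shift_linear a : linear (shift a).
Proof.
move=> c u v; apply/val_inj/funext => y.
change (c * u (act y a^-1%g) + v (act y a^-1%g) -
  (c * u (act x0 a^-1%g) + v (act x0 a^-1%g)) =
  c * (u (act y a^-1%g) - u (act x0 a^-1%g)) +
  (v (act y a^-1%g) - v (act x0 a^-1%g))); ring.
Qed.

HB.instance Definition _ a :=
  GRing.isLinear.Build R _ _ _ (shift a) (shift_linear a).

Lemma shift_norm_le a u : `|shift a u| <= `|u|.
Proof.
rewrite -(ler_pXn2r (n := 2)) // ?nnegrE // !rkhs_norm_sqr.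
have uH := rkhs_fun_in u; apply: energy_le; first exact: energy_ge0.
exact/shift_dominated/energy_dominated.
Qed.

(** The base point [x0] is embedded at the origin, so equivariance forces the origin to move to the
    point of [act x0 a]. *)
Definition affine_shift (u : rkhs based_kernel) a : rkhs based_kernel :=
  shift a u + rkhs_point based_kernel (act x0 a).

Lemma affine_shiftE u a y : affine_shift u a y =
  u (act y a^-1%g) - u (act x0 a^-1%g) + based (act x0 a) y.
Proof. by []. Qed.

Lemma rkhs_base (u : rkhs based_kernel) : u x0 = 0.
Proof.
have := rkhs_pairing_le u [:: (1, x0)].
rewrite /kform !pairing1 /= based0l sqrtr0 mulr0 normr_le0 => /eqP //.
Qed.

(** Evaluated at [y], this is equivariance of the embedding; at [x = act x0 a] it is also the
    cocycle identity that [affine_shiftM] needs. *)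
Lemma based_act a x y : based (act x a) y =
  based x (act y a^-1%g) - based x (act x0 a^-1%g) + based (act x0 a) y.
Proof.
have [kC _ _] := k_cnd.
have E z w : k z (act w a^-1%g) = k (act z a) w.
  by rewrite -(k_inv a) -ractM mulVg ract1.
have E' z w : k (act w a^-1%g) z = k (act z a) w by rewrite kC E.
by rewrite /based !(E, E'); field.
Qed.

Lemma affine_shift1 u : affine_shift u 1%g = u.
Proof.
apply/val_inj/funext => y.
by rewrite [LHS]affine_shiftE invg1 !ract1 rkhs_base subr0 based0l addr0.
Qed.

Lemma affine_shiftM u a b :
  affine_shift u (a * b)%g = affine_shift (affine_shift u a) b.
Proof.
apply/val_inj/funext => y.
rewrite [LHS]affine_shiftE [RHS]affine_shiftE !affine_shiftE.
by rewrite invgM !ractM (based_act b (act x0 a)); ring.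
Qed.

Definition affine_shift_action : rightAction Gam (rkhs_hilbert based_kernel) :=
  RightAction affine_shift1 affine_shiftM.

Lemma affine_shift_point x a :
  rkhs_point based_kernel (act x a) = affine_shift (rkhs_point based_kernel x) a.
Proof. by apply/val_inj/funext => y; exact: based_act. Qed.

Lemma affine_shift_isometric : affine_isometric_action affine_shift_action.
Proof.
have le a u v : `|affine_shift u a - affine_shift v a| <= `|u - v|.
  by rewrite /affine_shift opprD addrACA subrr addr0 -linearB shift_norm_le.
move=> a; split; first by exists (shift a), (rkhs_point based_kernel (act x0 a)).
move=> u v; apply/eqP; rewrite eq_le le /=.
have := le a^-1%g (affine_shift u a) (affine_shift v a).
by rewrite -!affine_shiftM mulgV !affine_shift1.
Qed.

End BasedKernel.

(** * Functions on the coarse groupoid *)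

Section OrbitFunctions.
Variables (R : realType) (X : metricType R) (Gam : groupType)
  (act : rightAction Gam X).
Hypotheses (act_free : free_action act) (act_isom : isometric_action act)
  (bgeom : bounded_geometry X).

Local Notation D := (orbit_space (diag_act act)).
Local Notation G := (coarse_groupoid act_free act_isom bgeom).
Local Notation Delta := (entourage_orbits act).

(** * Extension of functions by limits along ultrafilters *)

Section Extension.
Variable phi : D -> R^o.
Hypothesis phi_bounded : forall r, exists M : R, forall p, Delta r p -> `|phi p| <= M.

Definition extend (g : coarse_arrow act) : R^o := lim (phi @ sc_sets (asc g)).

(** An arrow lives on some [Delta r], where [phi] takes values in a compact interval; ultrafilters
    there converge. *)
Lemma extend_cvg g : phi @ sc_sets (asc g) --> extend g.
Proof.
have [r r0 gr] := arrow_bounded g; have [M phiM] := phi_bounded r.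
have := @segment_compact R (- M) M; rewrite compact_ultra.
move=> /(_ (phi @ sc_sets (asc g)) (sc_map_ultra phi (asc g))) [|z [_ gz]].
  by apply: (filterS _ gr) => p /phiM; rewrite ler_norml /= in_itv.
by apply/cvg_ex; exists z.
Qed.

Lemma extend_near g e : 0 < e -> sc_sets (asc g) [set p | `|extend g - phi p| <= e].
Proof.
move=> e0; have /cvgrPdist_le /(_ e e0) := @extend_cvg g; exact.
Qed.

(** The orbits where [phi] is [e]-close to [extend g] define a basic neighbourhood of [g]; the
    estimate passes to the limit along every arrow in it. *)
Lemma extend_continuous : continuous extend.
Proof.
move=> g; apply/(@cvgrPdist_le _ _ _ (nbhs g) (nbhs_filter g)) => e e0.
apply/arrow_nbhsP.
exists [set p | `|extend g - phi p| <= e]; first exact: extend_near.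
move=> h hA /=.
have gh : (fun p => `|extend g - phi p|) @ sc_sets (asc h) --> `|extend g - extend h|.
  by apply: cvg_norm; apply: cvgB; [exact: cvg_cst|exact: extend_cvg].
exact: (cvgr_to_le gh).
Qed.

Lemma extend_inv g : (forall p, phi (pair_inv p) = phi p) ->
  extend g = extend (coarse_inv act_isom g).
Proof.
move=> phiV; rewrite /extend -[in LHS](_ : phi \o @pair_inv _ _ _ act = phi) //.
exact/funext.
Qed.

Lemma extend_unit u : (forall v, phi (pair_unit v) = 0) ->
  extend (coarse_unit act_isom u) = 0.
Proof.
move=> phi1; rewrite /extend.
rewrite -[_ @ _]/((phi \o @pair_unit _ _ _ act) @ sc_sets u).
rewrite (_ : phi \o _ = fun=> 0); last exact/funext.
exact: lim_cst.
Qed.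

(* Arrows [g_i] with source [u] are simultaneously approximated by orbits
   [[x_i, y]], so that [[x_i, x_j]] approximates [g_i g_j^-1]. *)
Lemma extend_neg (u : stone_cech (orbit_space act)) n (g : 'I_n -> G) (c : 'I_n -> R) :
  (forall i, gsrc (g i) = u) ->
  (forall x : 'I_n -> X,
    \sum_(i < n) \sum_(j < n) c i * c j * phi (pair_of act (x i) (x j)) <= 0) ->
  \sum_(i < n) \sum_(j < n) c i * c j * extend (gmul (g i) (ginv (g j))) <= 0.
Proof.
move=> gu phi_neg.
pose C := \sum_(i < n) \sum_(j < n) `|c i * c j|.
have C0 : 0 <= C by apply: sumr_ge0 => i _; apply: sumr_ge0.
apply/ler_addgt0Pl => e e0; rewrite addr0.
(* The total error is at most [C * d <= e]; the [+ 1] covers [C = 0]. *)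
pose d := e / (C + 1); have d0 : 0 < d by rewrite divr_gt0 // ltr_wpDl.
have gij i j : composable (g i) (coarse_inv act_isom (g j)).
  by rewrite /composable coarse_rng_inv; have := gu i; rewrite -(gu j).
have /choice[AB HAB] (ij : 'I_n * 'I_n) : exists AB : set D * set D,
    [/\ sc_sets (asc (g ij.1)) AB.1,
        sc_sets (asc (coarse_inv act_isom (g ij.2))) AB.2 &
        forall p q k, AB.1 p -> AB.2 q -> pair_mul p q k ->
          `|extend (gmul (g ij.1) (ginv (g ij.2))) - phi k| <= d].
  case: ij => i j /=.
  have := extend_near (coarse_mul (g i) (coarse_inv act_isom (g j))) d0.
  move=> /(coarse_mulE act_free act_isom bgeom (gij i j))[A [B [gA gB ABd]]].
  exists (A, B); split=> // p q k Ap Bq pqk.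
  by apply: ABd; exists p, q.
(* Orbits near [g i] that are good at once as left factor, and inverted as right factor, of every
   product; finitely many conditions, so [E i] still belongs to [g i]. *)
pose E i : set D := [set p | forall j, (AB (i, j)).1 p /\ (AB (j, i)).2 (pair_inv p)].
have gE i : sc_sets (asc (g i)) (E i).
  apply: filter_forall => j; apply: filterI.
    by have [] := HAB (i, j).
  by have [] := HAB (j, i).
have uE : sc_sets u [set v | forall i, (@pair_src _ _ _ act @` E i) v].
  apply: filter_forall => i; have <- : coarse_src (g i) = u := gu i.
  suff : sc_sets (coarse_src (g i)) (@pair_src _ _ _ act @` E i) by [].
  by rewrite coarse_srcE; apply: (filterS _ (gE i)) => p; exists p.
(* A source orbit common to all the [E i]; fixing its representative lifts the approximations to
   pairs with the same second point. *)
have [v vE] := filter_ex uE.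
have /choice[x Hx] i : exists x, E i (pair_of act x (orbit_repr v)).
  by have [p Ep /pair_srcE[x px]] := vE i; exists x; rewrite -px.
apply: le_trans (_ : _ <= \sum_(i < n) \sum_(j < n)
  (c i * c j * phi (pair_of act (x i) (x j)) + `|c i * c j| * d)) _.
  apply: ler_sum => i _; apply: ler_sum => j _.
  rewrite -lerBlDl -mulrBr (le_trans (ler_norm _)) // normrM ler_wpM2l //.
  have [_ _] := HAB (i, j); apply; [exact: (Hx i j).1|exact: (Hx j i).2|].
  by rewrite pair_inv_of; exact: pair_mul_of.
under eq_bigr do rewrite big_split /= -mulr_suml.
rewrite big_split /= -mulr_suml -/C -[leRHS]add0r lerD ?phi_neg //.
by rewrite mulrCA ger_pMr // ler_pdivrMr ?ltr_wpDl // mul1r lerDl.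
Qed.

Lemma extend_proper :
  (forall M, exists2 r, 0 <= r & forall p, phi p <= M -> Delta r p) ->
  @proper_fun R G extend.
Proof.
move=> phi_proper K cK.
have [M [_ KM]] := compact_bounded cK.
(* Values in [K] are at most [M + 1], and [phi] is compared with [extend] up to 1. *)
have [r r0 rM] := phi_proper (M + 2).
apply: (subclosed_compact _ (Delta_compact (act := act) r0)).
  apply: (@preimage_closed (coarse_arrow act)).
    by move=> g _; exact: extend_continuous.
  by apply: compact_closed => //; exact: Rhausdorff.
move=> g Kg; apply: (filterS _ (extend_near g ltr01)) => p /= gp; apply: rM.
have M1 : M < M + 1 by rewrite ltrDl.
move: gp (KM _ M1 _ Kg) => /=; rewrite !ler_norml => /andP[g1 _] /andP[_ g2]; lra.
Qed.

End Extension.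

(** * Restriction of groupoid functions to kernels on the space *)

Section Restriction.
Variable psi : G -> R.
Hypothesis psi_cnd : cond_neg_def psi.

Definition groupoid_kernel (x y : X) : R^o := psi (pair_arrow (pair_of act x y)).

Lemma groupoid_kernel_act a x y :
  groupoid_kernel (act x a) (act y a) = groupoid_kernel x y.
Proof. by rewrite /groupoid_kernel pair_of_act. Qed.

Lemma groupoid_kernel_cnd : cnd_kernel groupoid_kernel.
Proof.
split=> [x y|x|s s0].
- rewrite /groupoid_kernel (cnd_sym psi_cnd); congr (psi _); apply/val_inj => /=.
  by rewrite -[LHS]/(sc_map _ (sc_in _)) sc_map_in pair_inv_of.
- rewrite /groupoid_kernel -(cnd_unit psi_cnd (sc_in (orbit_of act x))); congr (psi _).
  by apply/val_inj; rewrite /= sc_map_in pair_unit_of.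
case: s s0 => [_|p s']; first by rewrite /kform pairing_nil.
(* Any point [y] gives the arrows [[x_i, y]] a common source, with [g_i g_j^-1 = [x_i, x_j]]; the
   first point of the list is taken. *)
set s := p :: s' => s0; pose y := p.2.
have sumE (F : R * X -> R) : \sum_(q <- s) F q = \sum_(i < size s) F (nth p s i).
  by rewrite (big_nth p) big_mkord.
pose g (i : 'I_(size s)) : G := pair_arrow (pair_of act (nth p s i).2 y).
have := @cnd_neg _ _ _ psi_cnd (sc_in (orbit_of act y)) _ g
  (fun i => (nth p s i).1).
rewrite -(sumE (fun q => q.1)) => H.
rewrite /kform /pairing sumE; under eq_bigr do rewrite sumE mulr_sumr.
rewrite (eq_bigr (fun i : 'I_(size s) => \sum_(j < size s)
  (nth p s i).1 * (nth p s j).1 * psi (gmul (g i) (ginv (g j))))).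
  apply: H => [i|].
    by rewrite /g /= /coarse_src /= sc_map_in pair_src_of.
  by move: s0; rewrite /pairing; under eq_bigr do rewrite mulr1.
move=> i _; apply: eq_bigr => j _; rewrite mulrA; congr (_ * psi _).
have -> : ginv (g j) = pair_arrow (pair_of act y (nth p s j).2) :> G.
  by apply/val_inj; rewrite /= sc_map_in pair_inv_of.
apply/esym/(coarse_mul_pair act_free act_isom bgeom); exact: pair_mul_of.
Qed.

Lemma groupoid_kernel_bounded r : continuous psi ->
  exists M, forall x y, mdist x y <= r -> groupoid_kernel x y <= M.
Proof.
move=> psi_cont.
have cD : compact (psi @` [set g : coarse_arrow act | sc_sets (asc g) (Delta `|r|)]).
  apply: continuous_compact; last exact: Delta_compact.
  exact: continuous_subspaceT.
have [M [_ HM]] := compact_bounded cD; exists (M + 1) => x y xy.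
apply: le_trans (ler_norm _) _; apply: HM; first by rewrite ltrDl.
exists (pair_arrow (pair_of act x y)) => //; apply/sc_inE/(Delta_of act_isom).
by rewrite (le_trans xy) // ler_norm.
Qed.

(** The compact preimage of [[0, M]] is covered by the increasing open sets of arrows living on
    [Delta n], so one [n] suffices. *)
Lemma groupoid_kernel_proper M :
  proper_fun psi -> (forall x y, 0 <= groupoid_kernel x y) ->
  exists r, forall x y, groupoid_kernel x y <= M -> mdist x y <= r.
Proof.
move=> psi_proper ge0.
have /compact_near_coveringP near_K : compact
    ((psi : coarse_arrow act -> R) @^-1` [set` `[0, M]]).
  by apply: psi_proper; exact: segment_compact.
have [] := near_K nat \oo (fun n g => sc_sets (asc g) (Delta n%:R)) _.
  move=> g _; have [r _ gr] := arrow_bounded g.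
  exists ([set h | sc_sets (asc h) (Delta r)], [set n : nat | r <= n%:R]).
    split; last exact: nbhs_infty_ger.
    by apply/arrow_nbhsP; exists (Delta r).
  move=> [h n] /= [hr rn]; apply: (filterS _ hr) => _ [[x y] /= xy <-].
  by apply/(Delta_of act_isom); exact: le_trans rn.
move=> n _ Kn; exists n%:R => x y xy; apply/(Delta_of act_isom)/sc_inE.
apply: (Kn n (leqnn n) (pair_arrow (pair_of act x y))).
by rewrite /= in_itv /= ge0.
Qed.

End Restriction.
End OrbitFunctions.

(** * Equivariant coarse embeddings *)

Lemma coarse_control (R : realType) (X : metricType R) (D : X -> X -> R) :
  (forall x y, 0 <= D x y) ->
  (forall r, exists M, forall x y, mdist x y <= r -> D x y <= M) ->
  (forall M, exists r, forall x y, D x y <= M -> mdist x y <= r) ->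
  exists rhom rhop : R -> R,
    [/\ (forall t, 0 <= t -> 0 <= rhom t) /\ (forall t, 0 <= t -> 0 <= rhop t),
        (forall s t, 0 <= s -> s <= t -> rhom s <= rhom t) /\
        (forall s t, 0 <= s -> s <= t -> rhop s <= rhop t),
        rhom t @[t --> +oo] --> +oo &
        forall x y, rhom (mdist x y) <= D x y <= rhop (mdist x y)].
Proof.
move=> D0 Dbounded Dproper.
(* The suprema of [A t] and [B t] will be [rhom t] and [rhop t]. The cap [s <= t] keeps the first
   finite when no pair is at distance [t] or more; the value 0 makes [B t] nonempty. *)
pose A t := [set s | 0 <= s <= t /\ forall x y, t <= mdist x y -> s <= D x y].
pose B t := [set s | s = 0 \/ exists x y, mdist x y <= t /\ s = D x y].
have A0 t : 0 <= t -> A t 0 by move=> t0; split; rewrite ?lexx.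
have B0 t : B t 0 by left.
have supA t s : A t s -> s <= sup (A t).
  by apply: ub_le_sup; exists t => z [/andP[]].
have supB t s : B t s -> s <= sup (B t).
  apply: ub_le_sup; have [M DM] := Dbounded t; exists `|M| => z [-> //|[x [y [xy ->]]]].
  exact: le_trans (DM _ _ xy) (ler_norm M).
exists (sup \o A), (sup \o B); split=> /=.
- by split=> t t0; [exact/supA/A0|exact/supB].
- split=> s t s0 st.
    apply: ge_sup => [|z [/andP[z0 zs] zD]]; first by exists 0; exact: A0.
    apply: supA; split; first by rewrite z0 (le_trans zs).
    by move=> x y /(le_trans st)/zD.
  apply: ge_sup => [|z [->|[x [y [xy ->]]]]]; first by exists 0.
    exact: supB.
  by apply: supB; right; exists x, y; split=> //; exact: le_trans st.
(* Once [t >= |M|] and [t > r], the number [|M|] belongs to [A t]. *)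
- apply/cvgryPge => M; have [r Dr] := Dproper `|M|.
  have M0 : 0 <= `|M| := normr_ge0 M.
  near=> t; apply: le_trans (ler_norm M) _; apply: supA; split.
    by rewrite M0; near: t; exact: nbhs_pinfty_ge.
  move=> x y; apply: contraTT; rewrite -!ltNge => /ltW/Dr /le_lt_trans; apply.
  by near: t; apply: nbhs_pinfty_gt; exact: num_real.
move=> x y; apply/andP; split; last by apply: supB; right; exists x, y.
apply: ge_sup => [|z [_ zD]]; last exact: zD.
by exists 0; apply: A0; exact: mdist_ge0.
Unshelve. all: by end_near. Qed.

(** * Negative definiteness of squared Hilbert distances *)

Section HilbertDot.
Variables (R : realType) (H : hilbertSpace R).

Lemma hdotDl (u v w : H) : hdot (u + v) w = hdot u w + hdot v w.
Proof. by rewrite -[u in LHS]scale1r hdot_linear mul1r. Qed.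

Lemma hdot0l (w : H) : hdot 0 w = 0.
Proof. by have := hdotDl 0 0 w; rewrite addr0; lra. Qed.

Lemma hdotZl a (u w : H) : hdot (a *: u) w = a * hdot u w.
Proof. by rewrite -[_ *: u]addr0 hdot_linear hdot0l addr0. Qed.

Lemma hdot_suml (I : Type) (r : seq I) (F : I -> H) w :
  hdot (\sum_(i <- r) F i) w = \sum_(i <- r) hdot (F i) w.
Proof.
exact: (big_morph (fun v : H => hdot v w) (fun u v => hdotDl u v w) (hdot0l w)).
Qed.

Lemma dist_sqr (u v : H) : `|u - v| ^+ 2 = `|u| ^+ 2 - 2 * hdot u v + `|v| ^+ 2.
Proof.
rewrite -!hdot_norm -scaleN1r !(hdotDl, hdotZl) !(hdotC _ (_ + _)).
rewrite !(hdotDl, hdotZl) (hdotC v u); ring.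
Qed.

(* For weights of total mass [0] the sum is [-2 |sum c_i u_i|^2]. *)
Lemma dist_sqr_neg n (c : 'I_n -> R) (u : 'I_n -> H) : \sum_(i < n) c i = 0 ->
  \sum_(i < n) \sum_(j < n) c i * c j * `|u i - u j| ^+ 2 <= 0.
Proof.
move=> c0; pose w := \sum_(i < n) c i *: u i.
have wE : `|w| ^+ 2 = \sum_(i < n) \sum_(j < n) c i * c j * hdot (u i) (u j).
  rewrite -hdot_norm {1}/w hdot_suml; apply: eq_bigr => i _.
  rewrite hdotZl hdotC hdot_suml mulr_sumr; apply: eq_bigr => j _.
  by rewrite hdotZl (hdotC (u j)) mulrA.
suff -> : \sum_(i < n) \sum_(j < n) c i * c j * `|u i - u j| ^+ 2 = - 2 * `|w| ^+ 2.
  by rewrite mulNr oppr_le0 mulr_ge0 // sqr_ge0.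
transitivity (\sum_(i < n) \sum_(j < n) (c i * `|u i| ^+ 2 * c j +
    - 2 * (c i * c j * hdot (u i) (u j)) + c i * (c j * `|u j| ^+ 2))).
  by apply: eq_bigr => i _; apply: eq_bigr => j _; rewrite dist_sqr; ring.
under eq_bigr do rewrite !big_split /= -!mulr_sumr c0 mulr0 add0r.
by rewrite big_split /= -mulr_sumr -wE -mulr_suml c0 mul0r addr0.
Qed.

End HilbertDot.

Theorem theorem1p2 (R : realType) (X : metricType R) (Gam : groupType)
    (act : rightAction Gam X)
    (X_discrete : uniformly_discrete X)
    (X_bounded : bounded_geometry X)
    (Gam_countable : countable [set: Gam]%classic)
    (act_free : free_action act)
    (act_proper : proper_action act)
    (act_isom : isometric_action act) :
  equivariantly_embeddable act <->
  a_T_menable R (coarse_groupoid act_free act_isom X_bounded).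
Proof.
split=> [[H [actH [f [actH_isom [f_act]]]]]|].
  move=> [rhom [rhop [_ [rhomD rhopD] rhomoo f_rho]]].
  pose phi (p : orbit_space (diag_act act)) : R^o :=
    `|f (orbit_repr p).1 - f (orbit_repr p).2| ^+ 2.
  (* Equivariance of [f] and isometry of the action make the value independent of the chosen
     representatives. *)
  have phiE x y : phi (pair_of act x y) = `|f x - f y| ^+ 2.
    have /pair_ofP[a [E1 E2]] := pair_reprK (pair_of act x y).
    rewrite /phi; move: (orbit_repr _) E1 E2 => [x1 y1] /= -> ->.
    by rewrite !f_act (actH_isom a).2.
  have DeltaP r x y : entourage_orbits act r (pair_of act x y) <-> mdist x y <= r.
    exact: Delta_of.
  have rhomE x y : rhom (mdist x y) <= `|f x - f y| by have /andP[] := f_rho x y.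
  have rhopE x y : `|f x - f y| <= rhop (mdist x y) by have /andP[] := f_rho x y.
  have phi_bounded r :
      exists M : R, forall p, entourage_orbits act r p -> `|phi p| <= M.
    exists (rhop r ^+ 2) => p; have [x [y ->]] := pair_case p.
    rewrite DeltaP phiE => xy.
    have fxy : `|f x - f y| <= rhop r.
      exact: le_trans (rhopE x y) (rhopD _ _ (mdist_ge0 _ _) xy).
    by rewrite ger0_norm ?sqr_ge0 // lerXn2r ?nnegrE // (le_trans _ fxy).
  exists (extend phi); split.
  - exact: extend_continuous.
  - split=> [g|u|u n g c gu c0].
    + apply: extend_inv => p; have [x [y ->]] := pair_case p.
      by rewrite pair_inv_of !phiE distrC.
    + apply: extend_unit => v; rewrite -(orbit_reprK v) pair_unit_of phiE.
      by rewrite subrr normr0 expr0n.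
    + apply: extend_neg gu _ => // x.
      under eq_bigr do under eq_bigr do rewrite phiE.
      exact: dist_sqr_neg.
  apply: extend_proper => // M.
  (* Beyond distance [|r0| + 1] the embedded points are at least [|M| + 1] apart, so the squared
     distance exceeds [M]. *)
  have [r0 [_ Hr]] : \forall t \near +oo, `|M| + 1 <= rhom t.
    by move/cvgryPge : rhomoo; exact.
  have r1 : r0 < `|r0| + 1 by rewrite (le_lt_trans (ler_norm _)) // ltrDl.
  have r10 : 0 <= `|r0| + 1 by rewrite addr_ge0.
  exists (`|r0| + 1) => // p; have [x [y ->]] := pair_case p.
  rewrite DeltaP phiE => fM; rewrite leNgt; apply/negP => /ltW xy.
  have := le_trans (Hr _ r1) (le_trans (rhomD _ _ r10 xy) (rhomE x y)).
  move: fM (ler_norm M) (normr_ge0 M); move: `|f x - f y| `|M| => z m; nra.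
move=> [psi [psi_cont psi_cnd psi_proper]].
(* An empty space has no base point; the real line with the trivial action serves there, with
   control functions built from the zero kernel. *)
have [[x0 _]|noX] := pselect (exists x : X, True); last first.
  have pR (u v : R^o) : `|u + v| ^+ 2 + `|u - v| ^+ 2 = 2 * (`|u| ^+ 2 + `|v| ^+ 2).
    by rewrite !real_normK ?num_real //; ring.
  pose H : hilbertSpace R := hilbert_of_parallelogram pR.
  pose actH : rightAction Gam H :=
    @RightAction Gam H (fun v _ => v) (fun=> erefl) (fun _ _ _ => erefl).
  exists H, actH, (fun=> 0); split.
    by move=> a; split=> //; exists idfun, 0 => v; rewrite addr0.
  split=> [x|]; first by case: noX; exists x.
  have none (P : X -> Prop) x : P x by case: noX; exists x.
  have [rhom [rhop [? ? ? _]]] := @coarse_control R X (fun _ _ => 0)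
    (fun _ _ => lexx _) (fun _ => ex_intro _ 0 (none _)) (fun _ => ex_intro _ 0 (none _)).
  by exists rhom, rhop; split=> // x; case: noX; exists x.
pose k := groupoid_kernel psi.
have k_cnd : cnd_kernel k by exact: groupoid_kernel_cnd.
have k_inv a x y : k (act x a) (act y a) = k x y by exact: groupoid_kernel_act.
pose f := rkhs_point (based_kernel x0 k_cnd).
have fk x y : `|f x - f y| ^+ 2 = k x y by exact: based_point_dist.
exists (rkhs_hilbert (based_kernel x0 k_cnd)), (affine_shift_action x0 k_cnd k_inv), f.
split; first exact: affine_shift_isometric.
split; first by move=> x a; exact: affine_shift_point.
apply: (@coarse_control _ X (fun x y => `|f x - f y|)) => [//|r|M].
  have [M kM] := groupoid_kernel_bounded r psi_cont.
  exists (Num.sqrt M) => x y xy.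
  by rewrite -(ger0_norm (normr_ge0 _)) -sqrtr_sqr ler_wsqrtr // fk kM.
have [r kr] := groupoid_kernel_proper (M ^+ 2) psi_proper
  (fun x y => cnd_kernel_ge0 x y k_cnd).
exists r => x y xy; apply: kr; rewrite -[leLHS]fk lerXn2r ?nnegrE //.
exact: le_trans xy.
Qed.
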